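(* Let $v_1, v_2 \in S^2$ be any two mutually perpendicular directions (unit vectors in $\mathbb{R}^3$ with $v_1 \cdot v_2 = 0$). Then: (a) there exists a body $B \subset \mathbb{R}^3$ that has zero resistance in both directions $v_1$ and $v_2$; (b) there exists a body $B \subset \mathbb{R}^3$ that is invisible in both directions $v_1$ and $v_2$.
   Context: A body is a bounded set $B \subset \mathbb{R}^3$ with piecewise smooth boundary and positive volume (Lebesgue measure) $|B|>0$. A body is not required to be connected. Billiard scattering. Let $B$ be a body. Consider the billiard in $\mathbb{R}^3 \setminus B$: a point particle moves with unit speed along straight lines in $\mathbb{R}^3\setminus B$ and is reflected elastically (angle of incidence equals angle of reflection) at regular points of $\partial B$. Take a convex body $C$ containing $B$. For a regular point $\xi \in \partial C$ let $n(\xi)$ be the unit outer normal to $\partial C$ at $\xi$. For a regular point $\xi\in\partial C$ and $v \in S^2$ with $n(\xi)\cdot v \le 0$, let a particle enter $C$ at $\xi$ with velocity $v$. It moves in $C$, possibly making reflections from $\partial B$, and finally leaves $C$ at a point denoted $\xi^+_{B,C}(\xi,v) \in \partial C$ with a velocity denoted $v^+_{B,C}(\xi,v) \in S^2$, after which it moves freely. The quantities $\xi^+_{B,C}(\xi,v)$ and $v^+_{B,C}(\xi,v)$ are not defined if the particle hits $\partial B$ at a singular point, or gets trapped in $C$, or makes infinitely many reflections in a finite time. Zero resistance. $B$ has zero resistance in the direction $v \in S^2$ if $v^+_{B,C}(\xi,v)$ is defined and equal to $v$ for almost every $\xi \in \{\xi\in\partial C : n(\xi)\cdot v \le 0\}$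 with respect to the measure $(-n(\xi)\cdot v)\,d\xi$, where $d\xi$ is surface area on $\partial C$. Invisibility. $B$ is invisible in the direction $v\in S^2$ if it has zero resistance in the direction $v$ and, additionally, $\xi^+_{B,C}(\xi,v) - \xi$ is parallel to $v$ for almost every such $\xi$ (with respect to the same measure). These properties do not depend on the choice of the convex body $C \supset B$. *)

(* Defs.v *)
From HB Require Import structures.
From mathcomp Require Import all_boot all_order all_algebra.
From mathcomp Require Import all_classical all_reals all_analysis.
Set Implicit Arguments.
Unset Strict Implicit.
Unset Printing Implicit Defensive.
Import Order.TTheory GRing.Theory Num.Theory.
Import numFieldNormedType.Exports.
Local Open Scope classical_set_scope.
Local Open Scope ring_scope.

Section Euclidean.
Context {R : realType}.

Definition dot n (u v : 'rV[R]_n) : R := \sum_(i < n) u 0 i * v 0 i.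

Definition enorm n (u : 'rV[R]_n) : R := Num.sqrt (dot u u).

Definition parallel n (u v : 'rV[R]_n) : Prop := exists k : R, u = k *: v.

Definition reflection n (nu v : 'rV[R]_n) : 'rV[R]_n := v - (2 * dot v nu) *: nu.

End Euclidean.

Section SmoothSurfaces.
Context {R : realType}.

Fixpoint Ck (k : nat) m (W : normedModType R) (f : 'rV[R]_m -> W) : Prop :=
  if k is k'.+1 then
    (forall x, differentiable f x) /\
    (forall i : 'I_m, Ck k' (fun x => 'D_(delta_mx 0 i) f x))
  else continuous f.

Definition smooth m (W : normedModType R) (f : 'rV[R]_m -> W) : Prop :=
  forall k, Ck k f.

Definition gradient m (g : 'rV[R]_m -> R^o) (x : 'rV[R]_m) : 'rV[R]_m :=
  \row_(i < m) 'D_(delta_mx 0 i) g x.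

(* x is a regular point of S, with unit normal nu (determined up to sign):
   near x, the set S is the zero locus of a smooth function g whose gradient
   at x is nonzero and normal to S. *)
Definition unit_normal m (S : set 'rV[R]_m) (x nu : 'rV[R]_m) : Prop :=
  dot nu nu = 1 /\
  exists g : 'rV[R]_m -> R^o,
    [/\ smooth g, S x, (\forall y \near x, S y <-> g y = 0),
        gradient g x != 0 & parallel nu (gradient g x)].

Definition open_square : set 'rV[R]_2 := [set p | forall i, 0 < p 0 i < 1].
Definition closed_square : set 'rV[R]_2 := [set p | forall i, 0 <= p 0 i <= 1].

(* S is a finite union of smooth patches parametrized by the unit square.
   Each patch is an injective immersion of the open square, but may degenerate
   on the four edges (so that triangular faces, cusps and conical points are
   allowed); distinct patches meet only along images of edges. *)
Definition piecewise_smooth_surface (S : set 'rV[R]_3) : Prop :=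
  exists (N : nat) (phi : 'I_N -> 'rV[R]_2 -> 'rV[R]_3),
  [/\ forall i, smooth (phi i),
      forall i p, open_square p -> \rank ('J (phi i) p) = 2%N,
      forall i j p q, open_square p -> closed_square q ->
        phi i p = phi j q -> i = j /\ p = q
    & S = \bigcup_(i in [set: 'I_N]) (phi i @` closed_square)].

End SmoothSurfaces.

Section Bodies.
Context {R : realType}.

Definition boundary (T : topologicalType) (A : set T) : set T :=
  closure A `\` interior A.

(* Lebesgue outer measure on R^3.  It is the Lebesgue measure of every
   Lebesgue measurable set, hence of every bounded set whose boundary is
   piecewise smooth; such a set need not be Borel. *)
Definition volume (A : set 'rV[R]_3) : \bar R :=
  ((((@lebesgue_measure R \x @lebesgue_measure R) \x @lebesgue_measure R)%E)^*)%mu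
    ((fun x : 'rV[R]_3 => (x 0 0, x 0 1, x 0 2%:R)) @` A).

Definition body (B : set 'rV[R]_3) : Prop :=
  [/\ bounded_set B, piecewise_smooth_surface (boundary B)
    & (0 < volume B)%E].

Definition convex_body (C : set 'rV[R]_3) : Prop :=
  body C /\ @convex_set R 'rV[R]_3 C.

Definition outer_normal (C : set 'rV[R]_3) (xi nu : 'rV[R]_3) : Prop :=
  unit_normal (boundary C) xi nu /\ forall y, C y -> dot nu (y - xi) <= 0.

End Bodies.

Section SurfaceArea.
Context {R : realType}.
Local Open Scope ereal_scope.

(* equal to 0 on the empty set *)
Definition ediam (U : set 'rV[R]_3) : \bar R :=
  maxe 0 (ereal_sup [set (enorm (x - y))%:E | x in U & y in U]).

(* pi / 4 * (diam U)^2 is the area of a disk of diameter diam U. *)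
Definition disk_area (U : set 'rV[R]_3) : \bar R :=
  (pi / 4)%:E * (ediam U * ediam U).

Definition fine_cover (delta : R) (A : set 'rV[R]_3) :
    set (nat -> set 'rV[R]_3) :=
  [set F | A `<=` \bigcup_k F k /\ forall k, ediam (F k) <= delta%:E].

Definition hausdorff2_content (delta : R) (A : set 'rV[R]_3) : \bar R :=
  ereal_inf [set \sum_(k <oo) disk_area (F k) | F in fine_cover delta A].

(* Two-dimensional Hausdorff measure, normalized so as to coincide with the
   area on surfaces. *)
Definition surface_area (A : set 'rV[R]_3) : \bar R :=
  ereal_sup [set hausdorff2_content delta A | delta in [set d : R | (0 < d)%R]].

Lemma ediam_ge0 U : 0 <= ediam U.
Proof. by rewrite /ediam le_max lexx. Qed.

Lemma ediam_set0 : ediam set0 = 0.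
Proof.
rewrite /ediam; apply/max_idPl.
suff -> : [set (enorm (x - y))%:E | x in (set0 : set 'rV[R]_3) & y in set0]
    = set0 by rewrite ereal_sup0 leNye.
by apply/seteqP; split => // x [].
Qed.

Lemma disk_area_ge0 U : 0 <= disk_area U.
Proof.
rewrite /disk_area mule_ge0 ?mule_ge0 ?ediam_ge0// lee_fin.
by rewrite divr_ge0// pi_ge0.
Qed.

Lemma disk_area0 : disk_area set0 = 0.
Proof. by rewrite /disk_area ediam_set0 !mule0. Qed.

Lemma hausdorff2_content_ge0 d A : 0 <= hausdorff2_content d A.
Proof.
apply: le_ereal_inf_tmp => _ [F _ <-].
by apply: nneseries_ge0 => n _ _; exact: disk_area_ge0.
Qed.

Lemma hausdorff2_content_sigma_subadditive d :
  sigma_subadditive (hausdorff2_content d).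
Proof.
move=> A; have [[i ioo]|] := pselect (exists i, hausdorff2_content d (A i) = +oo).
  rewrite (eseries_pinfty _ _ ioo) ?leey// => n _.
  by rewrite -ltNye (lt_le_trans _ (hausdorff2_content_ge0 _ _)).
rewrite -forallNE => Aoo.
suff add2e (e : {posnum R}) : hausdorff2_content d (\bigcup_n A n) <=
    \sum_(i <oo) hausdorff2_content d (A i) + e%:num%:E.
  by apply/lee_addgt0Pr => _/posnumP[].
rewrite (le_trans _ (epsilon_trick _ _ _))//; last first.
  by move=> n; exact: hausdorff2_content_ge0.
pose P n (B : nat -> set 'rV[R]_3) := fine_cover d (A n) B /\
  \sum_(k <oo) disk_area (B k) <=
    hausdorff2_content d (A n) + (e%:num / (2 ^ n.+1)%:R)%:E.
have [G PG] : {G : nat -> nat -> set 'rV[R]_3 & forall n, P n (G n)}.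
  apply: (@choice _ _ P) => n; rewrite /P /hausdorff2_content.
  set S := (X in ereal_inf X); move infS : (ereal_inf S) => iS.
  case: iS infS => [r Sr|Soo|Soo].
  - have en1 : (0 < e%:num / (2 ^ n.+1)%:R)%R by [].
    have /(lb_ereal_inf_adherent en1) : ereal_inf S \is a fin_num by rewrite Sr.
    move=> [x [B BA xS]]; rewrite -xS => muBx.
    by exists B; split => //; rewrite -Sr; exact/ltW.
  - by have := Aoo n; rewrite /hausdorff2_content Soo.
  - by have := hausdorff2_content_ge0 d (A n); rewrite /hausdorff2_content Soo.
have G_ge0 x : 0 <= (disk_area \o uncurry G) x by exact: disk_area_ge0.
apply: (@le_trans _ _ (\esum_(i in setT) (disk_area \o uncurry G) i)).
  apply: ereal_inf_lbound => /=.
  have /card_esym/ppcard_eqP[f] := card_nat2.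
  exists (uncurry G \o f).
    split => [t [i _ Ait]|i]; last first.
      by rewrite /=; case: (f i) => a b /=; have [[_ +] _] := PG a; apply.
    have [[/(_ _ Ait)[j _ Gij] _] _] := PG i.
    by exists (f^-1%FUN (i, j)) => //=; rewrite invK ?inE.
  rewrite -(esum_pred_image (disk_area \o uncurry G) _ xpredT) ?[fun=> _]set_true//.
  by rewrite image_eq.
rewrite (_ : esum _ _ = \sum_(i <oo) \sum_(j <oo) disk_area (G i j)); last first.
  pose J : nat -> set (nat * nat) := fun i => [set (i, j) | j in setT].
  rewrite (_ : setT = \bigcup_k J k); last first.
    by rewrite predeqE => -[a b]; split => // _; exists a => //; exists b.
  rewrite esum_bigcupT /=; last 2 first.
    - apply/trivIsetP => i j _ _ ij.
      rewrite predeqE => -[n m] /=; split => //= -[] [_] _ [<-{n} _].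
      by move=> [m' _] [] /esym/eqP; rewrite (negbTE ij).
    - by move=> /= [n m]; exact: disk_area_ge0.
  rewrite -(image_id [set: nat]) -fun_true esum_pred_image//; last first.
    by move=> n _; apply: esum_ge0 => ? _; exact: disk_area_ge0.
  apply: eq_eseriesr => /= j _.
  rewrite -(esum_pred_image (disk_area \o uncurry G) (pair j) predT)//=; last 2 first.
    by move=> n _; exact: disk_area_ge0.
    by move=> ? ? _ _; exact: (@can_inj _ _ _ snd).
  by congr esum; rewrite predeqE => -[a b]; split; move=> [i _ <-]; exists i.
apply: lee_lim.
- apply: is_cvg_nneseries => n *.
  by apply: nneseries_ge0 => m *; exact: (G_ge0 (n, m)).
- apply: is_cvg_nneseries => n *; apply: adde_ge0 => //.
  exact: hausdorff2_content_ge0.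
- by near=> n; apply: lee_sum => i _; exact: (PG i).2.
Unshelve. all: by end_near. Qed.

Let surface_area0 : surface_area set0 = 0.
Proof.
apply/eqP; rewrite eq_le; apply/andP; split; last first.
  apply: (le_trans (hausdorff2_content_ge0 1 set0)).
  by apply: ereal_sup_ubound; exists 1%R => /=.
apply: ge_ereal_sup => _ [d /= d0 <-].
apply: ereal_inf_lbound; exists (fun=> set0).
  by split => // k; rewrite ediam_set0 lee_fin ltW.
by apply: eseries0 => k _ _; exact: disk_area0.
Qed.

Let surface_area_ge0 A : 0 <= surface_area A.
Proof.
apply: (le_trans (hausdorff2_content_ge0 1 A)).
by apply: ereal_sup_ubound; exists 1%R => /=.
Qed.

Let le_surface_area : {homo surface_area : A B / A `<=` B >-> A <= B}.
Proof.
move=> A B AB; apply: ge_ereal_sup => _ [d d0 <-].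
apply: (@le_trans _ _ (hausdorff2_content d B)); last first.
  by apply: ereal_sup_ubound; exists d.
apply: ereal_inf_le_tmp => _ [F [BF Fd] <-]; exists F => //; split => //.
exact: subset_trans AB BF.
Qed.

Let surface_area_sigma_subadditive : sigma_subadditive surface_area.
Proof.
move=> F; apply: ge_ereal_sup => _ [d d0 <-].
apply: (le_trans (hausdorff2_content_sigma_subadditive d F)).
apply: lee_nneseries => [k _ _|k _]; first exact: hausdorff2_content_ge0.
by apply: ereal_sup_ubound; exists d.
Qed.

HB.instance Definition _ := isOuterMeasure.Build R 'rV[R]_3 surface_area
  surface_area0 surface_area_ge0 le_surface_area surface_area_sigma_subadditive.

Definition surface_outer_measure : {outer_measure set 'rV[R]_3 -> \bar R} :=
  surface_area.

(* [surface_area] on the sigma-algebra of Caratheodory measurable sets *)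
Definition area_measure :
    {measure set (caratheodory_type surface_outer_measure) -> \bar R} :=
  (surface_outer_measure : set (caratheodory_type surface_outer_measure) -> \bar R).

End SurfaceArea.

Section Billiards.
Context {R : realType}.
Implicit Types (B C : set 'rV[R]_3) (x v y w xi : 'rV[R]_3).

(* A particle leaving x with velocity v moves freely until it first meets the
   closure of B, at the regular boundary point y; it is reflected there and
   acquires the velocity w.  The starting point x may lie on the boundary of B.
   A tangential contact counts as a reflection with w = v. *)
Definition bounce B x v y w : Prop :=
  exists (t : R) (nu : 'rV[R]_3),
  [/\ 0 < t, y = x + t *: v,
      forall s, 0 < s < t -> ~ closure B (x + s *: v),
      unit_normal (boundary B) y nu & w = reflection nu v].

(* A particle leaving x with velocity v makes finitely many reflections, all at
   regular points, and then leaves C for good at x' with velocity v'. *)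
Inductive motion B C x v x' v' : Prop :=
| Exit (t : R) of 0 <= t & x' = x + t *: v & v' = v & boundary C x'
    & (forall s, 0 < s -> ~ closure B (x + s *: v))
    & (forall s, 0 < s -> ~ closure C (x' + s *: v))
| Bounce y w of bounce B x v y w & motion B C y w x' v'.

(* The graph of the partial map (xi, v) |-> (xi+_{B,C}, v+_{B,C}).  If
   the boundaries of B and C share the entrance point xi, then the particle is
   reflected at once. *)
Definition scattering B C xi v xi' v' : Prop :=
  (~ closure B xi /\ motion B C xi v xi' v') \/
  (exists2 nu, unit_normal (boundary B) xi nu &
     motion B C xi (reflection nu v) xi' v').

Definition normal_at C xi : 'rV[R]_3 := xget 0 (outer_normal C xi).

(* the regular points xi of the boundary of C such that n(xi) . v <= 0 *)
Definition incoming C v : set 'rV[R]_3 :=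
  [set xi | exists2 nu, outer_normal C xi nu & dot nu v <= 0].

(* the measure (- n(xi) . v) d xi on [incoming C v] *)
Definition incoming_flux C v
    (A : set (caratheodory_type (@surface_outer_measure R))) : \bar R :=
  (\int[area_measure]_(xi in A `&` incoming C v)
     (- dot (normal_at C xi) v)%:E)%E.

Definition almost_every_incoming C v (P : 'rV[R]_3 -> Prop) : Prop :=
  (incoming_flux C v).-negligible [set xi | incoming C v xi /\ ~ P xi].

(* The following two properties do not depend on the choice of the convex
   body C containing B; they are required of all such C. *)
Definition zero_resistance B v : Prop :=
  forall C, convex_body C -> B `<=` C ->
    almost_every_incoming C v (fun xi => exists xi', scattering B C xi v xi' v).

Definition invisible B v : Prop :=
  zero_resistance B v /\
  forall C, convex_body C -> B `<=` C ->
    almost_every_incoming C v (fun xi =>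
      exists xi' v', scattering B C xi v xi' v' /\ parallel (xi' - xi) v).

End Billiards.

(* Main.v *)
From HB Require Import structures.
Require Import Defs.
From mathcomp Require Import all_boot all_order all_algebra.
From mathcomp Require Import all_classical all_reals all_analysis.
From mathcomp Require Import ring lra.
Set Implicit Arguments.
Unset Strict Implicit.
Unset Printing Implicit Defensive.
Import Order.TTheory GRing.Theory Num.Theory.
Import numFieldNormedType.Exports HBNNSimple.
Local Open Scope classical_set_scope.
Local Open Scope ring_scope.

(* With h(z) = (z^2 - 1)/2, the body is the solid {1 <= z <= 2, |x| <= h(z),
   |y| <= h(z)} together with a two-sided plane mirror of zero thickness
   {z = 0, |x| <= 2, |y| <= 2}, in orthonormal coordinates whose first two axes
   are v1 and v2.  A particle moving along the x-axis at height z, 1 < z < 2, in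
   the plane of a given y with |y| < h(z) is reflected by the parabola x = -h(z)
   to its focus (0, y, 0), there by the plane mirror to the parabola x = h(z),
   which has the same focus, and leaves along its original line.  All other
   particles miss the body, up to a negligible set, and exchanging x and y
   preserves the body, so that it is invisible in both directions.
   A particle is exceptional only if its (y, z) lies on one of finitely many
   curves G.  The points of the boundary of C lying over G where the normal n
   satisfies |n . v| >= 1/k form a Lipschitz graph over G, hence have zero area;
   where n . v = 0 the density of the flux vanishes. *)

(** The difficulty is that [C] is an arbitrary convex body around the mirrors and that its normal
    field is not known to be measurable, while negligibility asks for a measurable cover of flux
    zero. Null sets are always measurable in the sense of Caratheodory, but the planes z = 0 and z =
    2 may contain flat pieces of the boundary of [C] of positive area. Their measurability is
    obtained from Caratheodory's metric criterion, and this is why surface area must be shown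
    additive on sets at positive distance. The curves |y| = h(z) need no such care: for 1 <= z < 2 a
    line along v over them passes through the interior of the convex hull of the body, so no
    supporting plane of [C] is parallel to v there, and the entrance points are all transversal and
    form a null set. *)

Section DotProduct.
Context {R : realType} {n : nat}.
Implicit Types u v w : 'rV[R]_n.

Lemma dotC u v : dot u v = dot v u.
Proof. by apply: eq_bigr => i _; rewrite mulrC. Qed.

(** The target [R^o] makes this a linear map between normed modules, so that additivity and, once
    continuity is known, derivatives come from general facts on linear maps. *)
Definition dotr w u : R^o := dot u w.

Lemma dotr_is_linear w : linear (dotr w).
Proof.
move=> a u v; rewrite /dotr /dot scaler_sumr -big_split; apply: eq_bigr => i _ /=.
by rewrite !mxE mulrDl -mulrA.
Qed.

HB.instance Definition _ w :=
  @GRing.isLinear.Build R 'rV[R]_n R^o _ (dotr w) (dotr_is_linear w).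

Lemma dotDl u v w : dot (u + v) w = dot u w + dot v w.
Proof. exact: (raddfD (dotr w)). Qed.
Lemma dotBl u v w : dot (u - v) w = dot u w - dot v w.
Proof. exact: (raddfB (dotr w)). Qed.
Lemma dotNl u w : dot (- u) w = - dot u w.
Proof. exact: (raddfN (dotr w)). Qed.
Lemma dot0l w : dot 0 w = 0.
Proof. exact: (raddf0 (dotr w)). Qed.
Lemma dotZl a u w : dot (a *: u) w = a * dot u w.
Proof. exact: (linearZZ (dotr w)). Qed.
Lemma dotDr u v w : dot w (u + v) = dot w u + dot w v.
Proof. by rewrite !(dotC w) dotDl. Qed.
Lemma dotBr u v w : dot w (u - v) = dot w u - dot w v.
Proof. by rewrite !(dotC w) dotBl. Qed.
Lemma dotNr u w : dot w (- u) = - dot w u.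
Proof. by rewrite !(dotC w) dotNl. Qed.
Lemma dotZr a u w : dot w (a *: u) = a * dot w u.
Proof. by rewrite !(dotC w) dotZl. Qed.

Definition dotE := (dotDl, dotDr, dotBl, dotBr, dotNl, dotNr, dotZl, dotZr).

Lemma dotuu_ge0 u : 0 <= dot u u.
Proof. by apply: sumr_ge0 => i _; rewrite -expr2 sqr_ge0. Qed.

Lemma enorm_ge0 u : 0 <= enorm u.
Proof. exact: sqrtr_ge0. Qed.

Lemma sqr_enorm u : enorm u ^+ 2 = dot u u.
Proof. by rewrite sqr_sqrtr// dotuu_ge0. Qed.

Lemma enorm_le u a : 0 <= a -> (enorm u <= a) = (dot u u <= a ^+ 2).
Proof. by move=> a0; rewrite -sqr_enorm ler_pXn2r ?nnegrE ?enorm_ge0. Qed.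

(** Cauchy-Schwarz for a unit vector: expand the square of the component of [u] across [v]. *)
Lemma sqr_dot_le u v : dot v v = 1 -> dot u v ^+ 2 <= dot u u.
Proof.
move=> v1; have := dotuu_ge0 (u - dot u v *: v).
rewrite !dotE v1 (dotC v u); nra.
Qed.

Lemma abs_dot_le u v : dot v v = 1 -> `|dot u v| <= enorm u.
Proof.
move=> v1; rewrite -(@ler_pXn2r _ 2) ?nnegrE ?enorm_ge0// sqr_enorm.
by rewrite real_normK ?num_real// sqr_dot_le.
Qed.

Lemma dotr_continuous w : continuous (dotr w).
Proof.
rewrite /dotr /dot; elim: (index_enum _) => [|i r IH] x.
  by under eq_fun do rewrite big_nil; exact: cst_continuous.
under eq_fun do rewrite big_cons.
apply: cvgD; [exact: nbhs_filter| |exact: IH].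
apply: cvgM; [exact: nbhs_filter| |by apply: cvg_cst; exact: nbhs_filter].
exact: (@coord_continuous R 1 n 0 i).
Qed.

End DotProduct.

(** * Calculus of C^k maps *)

Section SmoothMaps.
Context {R : realType} {m : nat}.
Implicit Types (W : normedModType R) (v : 'rV[R]_m).

Lemma eq_Ck W k (f g : 'rV[R]_m -> W) : f =1 g -> Ck k f -> Ck k g.
Proof. by move=> /funext ->. Qed.

Lemma CkW W k (f : 'rV[R]_m -> W) : Ck k.+1 f -> Ck k f.
Proof.
elim: k f => [|k IH] f /= [fd fD].
  by move=> x; apply: differentiable_continuous; exact: fd.
split=> // i; apply: IH; exact: fD.
Qed.

Lemma Ck_cst W k (a : W) : Ck k (fun _ : 'rV[R]_m => a).
Proof.
elim: k a => [|k IH] a /=; first by move=> x; exact: cst_continuous.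
split=> [x|i]; first exact: differentiable_cst.
by apply: eq_Ck (IH 0) => x; rewrite derive_cst.
Qed.

Lemma CkD W k (f g : 'rV[R]_m -> W) :
  Ck k f -> Ck k g -> Ck k (fun x => f x + g x).
Proof.
elim: k f g => [|k IH] f g.
  by move=> fc gc x; apply: cvgD; [exact: nbhs_filter|exact: fc|exact: gc].
move=> [fd fD] [gd gD]; split=> [x|i]; first exact: differentiableD.
apply: eq_Ck (IH _ _ (fD i) (gD i)) => x /=.
by rewrite -deriveD//; exact: diff_derivable.
Qed.

(** The Leibniz rule brings back [f] and [g] themselves, so the induction has to lower their order
    with [CkW]. *)
Lemma CkM k (f g : 'rV[R]_m -> R^o) :
  Ck k f -> Ck k g -> Ck k (fun x => f x * g x : R^o).
Proof.
elim: k f g => [|k IH] f g.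
  by move=> fc gc x; apply: cvgM; [exact: nbhs_filter|exact: fc|exact: gc].
move=> fC gC; have [fd fD] := fC; have [gd gD] := gC.
split=> [x|i]; first exact: differentiableM.
apply: eq_Ck (CkD (IH _ _ (CkW fC) (gD i)) (IH _ _ (CkW gC) (fD i))) => x /=.
by rewrite -deriveM//; exact: diff_derivable.
Qed.

Lemma diff_scaler W (f : 'rV[R]_m -> R^o) (w : W) x : differentiable f x ->
  differentiable (fun y => f y *: w) x.
Proof. by move=> fd; apply: differentiableZl. Qed.

Lemma derive_scaler W (f : 'rV[R]_m -> R^o) (w : W) x v : differentiable f x ->
  'D_v (fun y => f y *: w) x = 'D_v f x *: w.
Proof.
move=> fd; rewrite !deriveE//; last exact: diff_scaler.
by rewrite diffZl.
Qed.

Lemma CkZ W k (f : 'rV[R]_m -> R^o) (w : W) :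
  Ck k f -> Ck k (fun x => f x *: w).
Proof.
elim: k f => [|k IH] f; first by move=> fc x; apply: cvgZr_tmp; [exact: nbhs_filter|exact: fc].
move=> [fd fD]; split=> [x|i]; first exact: diff_scaler.
apply: eq_Ck (IH _ (fD i)) => x /=.
by rewrite derive_scaler.
Qed.

Lemma differentiable_dotr (w x : 'rV[R]_m) :
  differentiable (dotr w) x.
Proof. apply: linear_differentiable; exact: dotr_continuous. Qed.

Lemma derive_dotr (w v x : 'rV[R]_m) : 'D_v (dotr w) x = dot v w.
Proof.
rewrite deriveE; last exact: differentiable_dotr.
by rewrite diff_lin//; exact: dotr_continuous.
Qed.

Lemma Ck_dotr k (w : 'rV[R]_m) : Ck k (dotr w).
Proof.
case: k => [|k]; first exact: dotr_continuous.
split=> [x|i]; first exact: differentiable_dotr.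
by apply: eq_Ck (Ck_cst k (dot (delta_mx 0 i) w : R^o)) => x; rewrite derive_dotr.
Qed.

Lemma dot_delta (x : 'rV[R]_m) i : dot x (delta_mx 0 i) = x 0 i.
Proof.
rewrite /dot (bigD1 i)//= mxE !eqxx mulr1 big1 ?addr0// => j ji.
by rewrite mxE (negbTE ji) andbF mulr0.
Qed.

Lemma Ck_coord k i : Ck k (fun x : 'rV[R]_m => x 0 i : R^o).
Proof. by apply: eq_Ck (Ck_dotr k (delta_mx 0 i)) => x; rewrite /dotr dot_delta. Qed.

Lemma deriveD_Ck W (f g : 'rV[R]_m -> W) x v : Ck 1 f -> Ck 1 g ->
  'D_v (fun y => f y + g y) x = 'D_v f x + 'D_v g x.
Proof. by move=> [fd _] [gd _]; rewrite -deriveD//; exact: diff_derivable. Qed.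

Lemma deriveM_Ck (f g : 'rV[R]_m -> R^o) x v : Ck 1 f -> Ck 1 g ->
  'D_v (fun y => f y * g y : R^o) x = f x * 'D_v g x + g x * 'D_v f x.
Proof. by move=> [fd _] [gd _]; rewrite -deriveM//; exact: diff_derivable. Qed.

End SmoothMaps.

(** * Orthonormal frames of 3-space *)

Section Frames.
Context {R : realType}.

Record orthonormal (e1 e2 e3 : 'rV[R]_3) : Prop := Orthonormal {
  dot11 : dot e1 e1 = 1; dot22 : dot e2 e2 = 1; dot33 : dot e3 e3 = 1;
  dot12 : dot e1 e2 = 0; dot13 : dot e1 e3 = 0; dot23 : dot e2 e3 = 0 }.

Lemma orthonormal_swap (e1 e2 e3 : 'rV[R]_3) :
  orthonormal e1 e2 e3 -> orthonormal e2 e1 e3.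
Proof. by case=> *; split=> //; rewrite dotC. Qed.

Lemma dot3E (u v : 'rV[R]_3) :
  dot u v = u 0 0 * v 0 0 + u 0 1 * v 0 1 + u 0 2%:R * v 0 2%:R.
Proof.
rewrite /dot !big_ord_recl big_ord0 addr0 addrA.
by congr (_ + _ + _); congr (u 0 _ * v 0 _); apply/val_inj.
Qed.

Lemma orthonormal_complete (e1 e2 : 'rV[R]_3) :
  dot e1 e1 = 1 -> dot e2 e2 = 1 -> dot e1 e2 = 0 ->
  exists e3, orthonormal e1 e2 e3.
Proof.
move=> h1 h2 h12.
(* The cross product of [e1] and [e2]. *)
pose e3 : 'rV[R]_3 := \row_(j < 3)
  nth 0 [:: e1 0 1 * e2 0 2%:R - e1 0 2%:R * e2 0 1;
            e1 0 2%:R * e2 0 0 - e1 0 0 * e2 0 2%:R;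
            e1 0 0 * e2 0 1 - e1 0 1 * e2 0 0] j.
exists e3; split=> //; move: h1 h2 h12; rewrite !dot3E !mxE /=; try by move=> *; ring.
move=> h1 h2 h12.
(* Lagrange's identity for the squared length of a cross product. *)
have -> : forall a b c x y z : R,
  (b * z - c * y) * (b * z - c * y) + (c * x - a * z) * (c * x - a * z)
  + (a * y - b * x) * (a * y - b * x) =
  (a * a + b * b + c * c) * (x * x + y * y + z * z) - (a * x + b * y + c * z) ^+ 2.
  by move=> *; ring.
by rewrite h1 h2 h12; ring.
Qed.

Context {e1 e2 e3 : 'rV[R]_3} (o : orthonormal e1 e2 e3).

(** For the matrix [A] with rows [e1], [e2], [e3], the relation A A^T = 1 forces A^T A = 1, and p =
    p A^T A is the expansion. *)
Lemma frameE (p : 'rV[R]_3) :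
  p = dot p e1 *: e1 + dot p e2 *: e2 + dot p e3 *: e3.
Proof.
pose A : 'M[R]_3 := \matrix_(i < 3, j < 3) nth e1 [:: e1; e2; e3] i 0 j.
have AAT : A *m A^T = 1%:M.
  apply/matrixP => i j; rewrite !mxE.
  transitivity (dot (nth e1 [:: e1; e2; e3] i) (nth e1 [:: e1; e2; e3] j)).
    by apply: eq_bigr => k _; rewrite !mxE.
  case: o => h1 h2 h3 h12 h13 h23.
  by case: i => [[|[|[|?]]] ?] //; case: j => [[|[|[|?]]] ?] //=; rewrite 1?dotC.
apply/rowP => j; rewrite -[p in LHS]mulmx1 -(mulmx1C AAT) mulmxA !mxE.
rewrite !big_ord_recl big_ord0 addr0 addrA !mxE.
by congr (_ * _ + _ * _ + _ * _); apply: eq_bigr => k _; rewrite !mxE.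
Qed.

Lemma dot_frame (u v : 'rV[R]_3) :
  dot u v = dot u e1 * dot v e1 + dot u e2 * dot v e2 + dot u e3 * dot v e3.
Proof. by rewrite {1}(frameE u) !dotE !(dotC v). Qed.

Definition point (e1 e2 e3 : 'rV[R]_3) (a b c : R) := a *: e1 + b *: e2 + c *: e3.

Lemma dot_pt1 a b c : dot (point e1 e2 e3 a b c) e1 = a.
Proof. by case: o => *; rewrite !dotE !(dotC _ e1); nra. Qed.
Lemma dot_pt2 a b c : dot (point e1 e2 e3 a b c) e2 = b.
Proof. case: o => *; rewrite !dotE (dotC e3); nra. Qed.
Lemma dot_pt3 a b c : dot (point e1 e2 e3 a b c) e3 = c.
Proof. case: o => *; rewrite !dotE; nra. Qed.

Definition dot_pt := (dot_pt1, dot_pt2, dot_pt3).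

Lemma frame_inj (u v : 'rV[R]_3) : dot u e1 = dot v e1 -> dot u e2 = dot v e2 ->
  dot u e3 = dot v e3 -> u = v.
Proof. by move=> a b c; rewrite [LHS]frameE [RHS]frameE a b c. Qed.

End Frames.

(** * Additivity of surface area on separated sets *)

Section HausdorffMeasure.
Context {R : realType}.
Local Open Scope ereal_scope.
Local Notation S2 := (@surface_outer_measure R).
Implicit Types A E U V T : set 'rV[R]_3.

Lemma le_ediam U V : U `<=` V -> ediam U <= ediam V.
Proof.
move=> UV; rewrite /ediam ge_max le_max lexx /= le_max; apply/orP; right.
by apply: ereal_sup_le => _ [x Ux [y Uy <-]]; exists x; [exact: UV|exists y; [exact: UV|]].
Qed.

Lemma ediam_ge U x y : U x -> U y -> (enorm (x - y))%:E <= ediam U.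
Proof.
move=> Ux Uy; rewrite /ediam le_max; apply/orP; right.
by apply: ereal_sup_ubound; exists x => //; exists y.
Qed.

Lemma ediam_le U (r : R) : (0 <= r)%R ->
  (forall x y, U x -> U y -> enorm (x - y) <= r)%R -> ediam U <= r%:E.
Proof.
move=> r0 H; rewrite /ediam ge_max lee_fin r0 /=.
by apply: ge_ereal_sup => _ [x Ux [y Uy <-]]; rewrite lee_fin H.
Qed.

Lemma le_disk_area U V : U `<=` V -> disk_area U <= disk_area V.
Proof.
move=> UV; rewrite /disk_area lee_pmul// ?mule_ge0 ?ediam_ge0//.
- by rewrite lee_fin divr_ge0// pi_ge0.
- by rewrite lee_pmul ?ediam_ge0 ?le_ediam.
Qed.

Lemma hausdorff2_content_le A (d d' : R) : (d <= d')%R ->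
  hausdorff2_content d' A <= hausdorff2_content d A.
Proof.
move=> dd'; apply: ereal_inf_le_tmp => _ [F [AF Fd] <-]; exists F => //; split => // k.
by apply: le_trans (Fd k) _; rewrite lee_fin.
Qed.

(** A covering set of diameter at most d < d0 cannot meet both [E1] and [E2], so each cover splits
    into covers of the two sets. *)
Lemma hausdorff2_content_sep E1 E2 (d0 d : R) : (d < d0)%R ->
  (forall x y, E1 x -> E2 y -> d0 <= enorm (x - y))%R ->
  hausdorff2_content d E1 + hausdorff2_content d E2 <=
  hausdorff2_content d (E1 `|` E2).
Proof.
move=> dd0 sep; apply: le_ereal_inf_tmp => _ [F [EF Fd] <-].
have cover E : E `<=` E1 `|` E2 -> hausdorff2_content d E <=
    \sum_(k <oo) disk_area (F k `&` E).
  move=> EE; apply: ereal_inf_lbound; exists (fun k => F k `&` E) => //; split.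
    by move=> x Ex; have [k _ Fk] := EF x (EE _ Ex); exists k.
  by move=> k; apply: le_trans (Fd k); apply: le_ediam => x [].
apply: le_trans (leeD (cover _ (@subsetUl _ E1 E2)) (cover _ (@subsetUr _ E1 E2))) _.
rewrite -nneseriesD; last 2 first.
- by move=> k _ _; exact: disk_area_ge0.
- by move=> k _ _; exact: disk_area_ge0.
apply: lee_nneseries => k _ ; first by rewrite adde_ge0 ?disk_area_ge0.
have [F1|/set0P[x [Fx E1x]]] := eqVneq (F k `&` E1) set0.
  by rewrite F1 disk_area0 add0e; apply: le_disk_area => x [].
have -> : F k `&` E2 = set0.
  apply/seteqP; split=> // y [Fy E2y]; have := sep _ _ E1x E2y.
  have := le_trans (ediam_ge Fx Fy) (Fd k); rewrite lee_fin => ? ?.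
  by have : (d0 <= d)%R by [apply: le_trans; eassumption|lra]; rewrite leNgt dd0.
by rewrite disk_area0 adde0; apply: le_disk_area => z [].
Qed.

Lemma surface_area_sep E1 E2 (d0 : R) : (0 < d0)%R ->
  (forall x y, E1 x -> E2 y -> d0 <= enorm (x - y))%R ->
  S2 E1 + S2 E2 <= S2 (E1 `|` E2).
Proof.
move=> d00 sep.
have key (d1 d2 : R) : (0 < d1)%R -> (0 < d2)%R ->
    hausdorff2_content d1 E1 + hausdorff2_content d2 E2 <= S2 (E1 `|` E2).
  (* Contents grow as the scale shrinks, so both scales may be replaced by a common one; d0 / 2
     keeps it strictly below the separation. *)
  move=> d1p d2p; pose d := Num.min (d0 / 2)%R (Num.min d1 d2).
  have dp : (0 < d)%R by rewrite !lt_min divr_gt0// d1p.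
  apply: (@le_trans _ _ (hausdorff2_content d E1 + hausdorff2_content d E2)).
    by apply: leeD; apply: hausdorff2_content_le; rewrite /d !ge_min lexx ?orbT.
  apply: (@le_trans _ _ (hausdorff2_content d (E1 `|` E2))).
    apply: (hausdorff2_content_sep _ sep).
    by rewrite /d gt_min; apply/orP; left; rewrite ltr_pdivrMr// ltr_pMr// ltr1n.
  by apply: ereal_sup_ubound; exists d.
have [|] := eqVneq (S2 (E1 `|` E2)) +oo; first by move=> ->; rewrite leey.
rewrite -ltey => fin.
(* The supremum over scales is taken in one summand at a time, by subtracting the other, which must
   be finite. *)
have c2fin (d : R) : (0 < d)%R -> hausdorff2_content d E2 \is a fin_num.
  move=> dp; rewrite ge0_fin_numE ?hausdorff2_content_ge0//.
  apply: le_lt_trans fin; apply: le_trans (key 1%R d ltr01 dp).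
  by rewrite leeDr// hausdorff2_content_ge0.
have s1 : S2 E1 + hausdorff2_content 1 E2 <= S2 (E1 `|` E2).
  rewrite -leeBrDr ?c2fin//; apply: ge_ereal_sup => _ [d /= dp <-].
  by rewrite leeBrDr ?c2fin// key.
have s1fin : S2 E1 \is a fin_num.
  rewrite ge0_fin_numE ?outer_measure_ge0//; apply: le_lt_trans fin.
  by apply: le_trans s1; rewrite leeDl// hausdorff2_content_ge0.
rewrite -leeBrDl//; apply: ge_ereal_sup => _ [d2 /= d2p <-].
rewrite leeBrDl// -leeBrDr ?c2fin//; apply: ge_ereal_sup => _ [d /= dp <-].
by rewrite leeBrDr ?c2fin// key.
Qed.

End HausdorffMeasure.

(** * Caratheodory's criterion and null curves *)

Section Caratheodory.
Context {R : realType}.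
Local Open Scope ereal_scope.
Local Notation S2 := (@surface_outer_measure R).

Section Sublevel.
Variable f : 'rV[R]_3 -> R.
Hypothesis flip : forall x y, (f x - f y <= enorm (x - y))%R.
Variable T : set 'rV[R]_3.

Let U n : set 'rV[R]_3 := T `&` [set x | (n.+1%:R^-1 <= f x)%R].
(** Here f lies between 1/(n+2), included, and 1/(n+1), excluded. Neighbouring shells may touch;
    shells two indices apart are at positive distance. *)
Let shell n : set 'rV[R]_3 := U n.+1 `&` [set x | (f x < n.+1%:R^-1)%R].

Let level_sep E1 E2 (a b : R) : (a < b)%R ->
  (forall x, E1 x -> b <= f x)%R -> (forall x, E2 x -> f x <= a)%R ->
  S2 E1 + S2 E2 <= S2 (E1 `|` E2).
Proof.
move=> ab E1b E2a; apply: (@surface_area_sep _ _ _ (b - a)); first by rewrite subr_gt0.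
by move=> x y /E1b bx /E2a ya; apply: le_trans (flip x y); rewrite lerB.
Qed.

Let leU m n : (m <= n)%N -> U m `<=` U n.
Proof.
move=> mn x [Tx fx]; split=> //=; apply: le_trans fx.
by rewrite lef_pV2 ?posrE ?ltr0n// ler_nat ltnS.
Qed.

Let shell_step m : S2 (U m) + S2 (shell m.+1) <= S2 (U m.+2).
Proof.
apply: (@le_trans _ _ (S2 (U m `|` shell m.+1))); last first.
  apply: le_outer_measure => x [|[]//]; exact: leU (leqW (leqnSn m)) x.
apply: (@level_sep _ _ m.+2%:R^-1 m.+1%:R^-1).
- by rewrite ltf_pV2 ?posrE ?ltr0n// ltr_nat.
- by move=> x [].
- by move=> x [_ /ltW].
Qed.

(** [shell m.+1] is separated from [U m] but touches [U m.+1]. The two terms on the right therefore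
    exchange roles at each step, one absorbing the shells of even index and the other those of odd
    index. *)
Let shell_sum m : \sum_(i < m.+1) S2 (shell i) <= S2 (U m.+1) + S2 (U m).
Proof.
elim: m => [|m IH].
  rewrite big_ord_recl big_ord0 adde0.
  apply: (@le_trans _ _ (S2 (U 1%N))); first by apply: le_outer_measure => x [].
  by rewrite leeDl// outer_measure_ge0.
rewrite big_ord_recr /=; apply: le_trans (leeD2r _ IH) _.
by rewrite -addeA [leRHS]addeC leeD2l// shell_step.
Qed.

Let shell_series : \sum_(i <oo) S2 (shell i) <= S2 T + S2 T.
Proof.
apply: lime_le; first by apply: is_cvg_nneseries => *; exact: outer_measure_ge0.
apply: nearW => -[|n].
  by rewrite big_geq// adde_ge0 ?outer_measure_ge0.
rewrite big_mkord; apply: le_trans (shell_sum n) _.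
by apply: leeD; apply: le_outer_measure => x [].
Qed.

Let cover n : T `&` ~` [set x | (f x <= 0)%R] `<=`
  U n `|` \bigcup_(i in ~` `I_n) shell i.
Proof.
move=> x [Tx /= /negP]; rewrite -ltNge => fx.
have : exists m, (m.+1%:R^-1 <= f x)%R.
  exists (Num.bound (f x)^-1); rewrite -[leRHS]invrK lef_pV2 ?posrE ?ltr0n ?invr_gt0//.
  apply/ltW/(lt_le_trans (archi_boundP _)); first by rewrite invr_ge0 ltW.
  by rewrite ler_nat.
case/ex_minnP => m fm mmin; have [mn|nm] := leqP m n.
  by left; apply: (leU mn).
right; case: m fm mmin nm => [//|m] fm mmin nm; exists m => /=.
  by apply/negP; rewrite -leqNgt.
by split; [split|]=> //=; rewrite ltNge; apply/negP => /mmin; rewrite ltnn.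
Qed.

(** Up to a tail of the convergent series of shells, the part where f > 0 is [U n], which lies at
    distance at least 1/(n+1) from the part where f <= 0. *)
Lemma sublevel_split :
  S2 (T `&` [set x | (f x <= 0)%R]) + S2 (T `&` ~` [set x | (f x <= 0)%R]) <= S2 T.
Proof.
have [|] := eqVneq (S2 T) +oo; first by move=> ->; rewrite leey.
rewrite -ltey => Tfin.
have sfin : \sum_(i <oo) S2 (shell i) < +oo.
  by apply: le_lt_trans shell_series _; rewrite lte_add_pinfty.
have tail := nneseries_tail_cvg sfin (fun k _ => outer_measure_ge0 _ _).
apply/lee_addgt0Pr => e e0.
have [n] : exists n, \sum_(n <= k <oo) S2 (shell k) < e%:E.
  have /tail [n _ nP] : nbhs (0 : \bar R) [set x : \bar R | x < e%:E].
    by apply: open_nbhs_nbhs; split=> //; exact: open_ereal_lt_ereal.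
  by exists n; apply: nP => /=.
move=> tn.
have h1 : S2 (T `&` ~` [set x | (f x <= 0)%R]) <= S2 (U n) + e%:E.
  apply: le_trans (le_outer_measure _ _ _ (@cover n)) _.
  apply: le_trans (outer_measureU2 _ _ _) _; apply: leeD2l; apply: le_trans (ltW tn).
  exact: outer_measure_sigma_subadditive_tail.
apply: le_trans (leeD2l _ h1) _; rewrite addeA; apply: leeD2r.
rewrite addeC; apply: (@le_trans _ _ (S2 (U n `|` (T `&` [set x | (f x <= 0)%R])))).
  apply: (@level_sep _ _ 0 n.+1%:R^-1) => [|x []//|x []//].
  by rewrite invr_gt0 ltr0n.
by apply: le_outer_measure => x [] [].
Qed.

End Sublevel.

(* Caratheodory's criterion: surface area is additive on sets at positive
   distance from each other. *)
Lemma caratheodory_sublevel (f : 'rV[R]_3 -> R) :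
  (forall x y, f x - f y <= enorm (x - y))%R ->
  S2.-caratheodory [set x | (f x <= 0)%R].
Proof.
by move=> flip; apply: le_caratheodory_measurable => T; exact: sublevel_split.
Qed.

Lemma caratheodory_null (A : set 'rV[R]_3) : S2 A = 0 -> S2.-caratheodory A.
Proof.
move=> A0; apply: le_caratheodory_measurable => T.
rewrite (_ : S2 (T `&` A) = 0) ?add0e; first by apply: le_outer_measure => x [].
apply/eqP; rewrite eq_le outer_measure_ge0 andbT -A0.
by apply: le_outer_measure => x [].
Qed.

(** Cutting the parameter interval into N parts covers [A] by N sets of diameter O(1/N), of total
    area O(1/N). *)
Lemma surface_area_curve0 (A : set 'rV[R]_3) (t : 'rV[R]_3 -> R) (a b L : R) :
  (forall x, A x -> a <= t x <= b)%R ->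
  (forall x y, A x -> A y -> enorm (x - y) <= L * `|t x - t y|)%R -> S2 A = 0.
Proof.
move=> tab tL; apply/eqP; rewrite eq_le outer_measure_ge0 andbT.
(* The absolute value allows a negative [L]. The extra 1 makes the length positive when a = b and
   gives t = b an index below [N]. *)
pose M := (`|L| * (b - a + 1))%R.
have [ba|ab] := ltP b a.
  rewrite (_ : A = set0) ?outer_measure0//; apply/seteqP; split=> // x /tab.
  by move=> /andP[p q]; have := le_trans p q; rewrite leNgt ba.
have c0 : (0 < b - a + 1)%R by lra.
have M0 : (0 <= M)%R by rewrite mulr_ge0// ltW.
apply: ge_ereal_sup => _ [d /= d0 <-]; apply/lee_addgt0Pr => e e0; rewrite add0e.
(* The first bound makes every piece of diameter at most d, the second makes the total area at most
   e. *)
pose N := (Num.bound (M / d) + Num.bound (pi / 4 * M ^+ 2 / e)).+1.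
have Np : (0 < N%:R :> R)%R by rewrite ltr0n.
have MN : (M / N%:R <= d)%R.
  rewrite ler_pdivrMr// mulrC -ler_pdivrMr//; apply/ltW.
  apply: lt_le_trans (archi_boundP _) _; first by rewrite divr_ge0// ltW.
  by rewrite ler_nat /N leqW// leq_addr.
have eN : (N%:R * (pi / 4 * (M / N%:R) ^+ 2) <= e)%R.
  have -> : (N%:R * (pi / 4 * (M / N%:R) ^+ 2) = pi / 4 * M ^+ 2 / N%:R)%R.
    by field; rewrite gt_eqF.
  rewrite ler_pdivrMr// [leRHS]mulrC -ler_pdivrMr//; apply/ltW.
  apply: lt_le_trans (archi_boundP _) _.
    by rewrite divr_ge0 ?(ltW e0)// mulr_ge0 ?sqr_ge0// divr_ge0// pi_ge0.
  by rewrite ler_nat /N leqW// leq_addl.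
pose k x := Num.trunc ((t x - a) / (b - a + 1) * N%:R).
have kP x : A x -> ((k x)%:R <= (t x - a) / (b - a + 1) * N%:R < (k x).+1%:R)%R.
  move=> /tab /andP[ax xb]; apply: truncn_itv; rewrite mulr_ge0 ?(ltW Np)//.
  by rewrite divr_ge0 ?subr_ge0// ltW.
have kN x : A x -> (k x < N)%N.
  move=> Ax; rewrite -(ltr_nat R); have /andP[h _] := kP _ Ax.
  apply: le_lt_trans h _; rewrite gtr_pMl// ltr_pdivrMr// mul1r.
  by have /andP[_ ?] := tab _ Ax; lra.
pose F i : set 'rV[R]_3 := A `&` [set x | k x = i].
have Fdiam i : ediam (F i) <= (M / N%:R)%:E.
  apply: ediam_le => [|x y [Ax kx] [Ay ky]]; first by rewrite divr_ge0// ltW.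
  apply: le_trans (tL _ _ Ax Ay) _.
  apply: (@le_trans _ _ (`|L| * `|t x - t y|)%R).
    by rewrite ler_wpM2r// ler_norm.
  rewrite /M -mulrA; apply: ler_wpM2l => //.
  have := kP _ Ax; have := kP _ Ay; rewrite kx ky => /andP[p1 p2] /andP[q1 q2].
  have key (u v : R) : (i%:R <= (u - a) / (b - a + 1) * N%:R)%R ->
      ((v - a) / (b - a + 1) * N%:R < i.+1%:R)%R -> (v - u <= (b - a + 1) / N%:R)%R.
    move=> h1 h2; rewrite ler_pdivlMr//.
    have : ((v - u) / (b - a + 1) * N%:R <= 1)%R.
      have -> : ((v - u) / (b - a + 1) * N%:R = (v - a) / (b - a + 1) * N%:R -
         (u - a) / (b - a + 1) * N%:R)%R by field; rewrite gt_eqF.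
      by move: h2; rewrite -natr1; lra.
    by rewrite mulrAC ler_pdivrMr// mul1r.
  by rewrite ler_norml lerNl opprB !key.
apply: (@le_trans _ _ (\sum_(i <oo) disk_area (F i))).
  apply: ereal_inf_lbound; exists F => //; split.
    by move=> x Ax; exists (k x).
  by move=> i; apply: le_trans (Fdiam i) _; rewrite lee_fin.
rewrite (nneseries_split 0%N N) => [|i _]; last exact: disk_area_ge0.
rewrite add0n [X in _ + X]eseries0 => [|i Ni _]; last first.
  rewrite (_ : F i = set0) ?disk_area0//; apply/seteqP; split=> // x [/kN kx /= xi].
  by move: kx; rewrite xi ltnNge Ni.
rewrite adde0; apply: (@le_trans _ _ (\sum_(0 <= i < N) (pi / 4 * (M / N%:R) ^+ 2)%:E)).
  apply: lee_sum => i _; rewrite /disk_area [leRHS]EFinM lee_pmul2l//; last first.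
    by rewrite lte_fin divr_gt0// pi_gt0.
  by rewrite EFinM lee_pmul ?ediam_ge0.
by rewrite big_mkord sumEFin sumr_const card_ord lee_fin -[leLHS]mulr_natl.
Qed.

End Caratheodory.

(** * Closed half-spaces and supporting planes *)

Section LevelSets.
Context {R : realType}.
Implicit Types (g : 'rV[R]_3 -> R^o) (C : set 'rV[R]_3).

Lemma closed_le_cst g (c : R) : continuous g -> closed [set x | g x <= c].
Proof.
move=> gc; apply: (@closed_comp _ _ g [set y : R | y <= c]); last exact: closed_le.
by move=> x _; exact: gc.
Qed.

Lemma open_lt_cst g (c : R) : continuous g -> open [set x | g x < c].
Proof.
move=> gc; apply: (@open_comp _ _ g [set y : R | y < c]); last exact: open_lt.
by move=> x _; exact: gc.
Qed.

Lemma closure_le_cst C g (c : R) : continuous g ->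
  (forall x, C x -> g x <= c) -> forall x, closure C x -> g x <= c.
Proof.
move=> gc Cg x /(closure_subset Cg).
by rewrite -(proj1 (closure_id _) (@closed_le_cst g c gc)).
Qed.

Lemma dot_bounded C (w : 'rV[R]_3) : bounded_set C ->
  exists2 M : R, 0 < M & forall x, closure C x -> `|dot x w| <= M.
Proof.
move=> /ex_strict_bound_gt0 [M M0 CM].
have [k k0 kP] := linear_lipschitz (@dotr_continuous R 3 w).
exists (k * M); first by rewrite mulr_gt0.
have kM x : C x -> `|dot x w| <= k * M.
  move=> Cx; apply: le_trans (kP x) _; rewrite ler_wpM2l ?(ltW k0)//.
  by apply: ltW; exact: CM.
move=> x Cx; rewrite ler_norml; apply/andP; split.
  rewrite lerNl -dotNr; apply: (@closure_le_cst C (dotr (- w))) Cx.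
    exact: dotr_continuous.
  by move=> y /kM; rewrite /dotr dotNr ler_norml => /andP[+ _]; rewrite lerNl.
apply: (@closure_le_cst C (dotr w)) Cx; first exact: dotr_continuous.
by move=> y /kM; rewrite ler_norml => /andP[].
Qed.

(** Boundary points of [C] need not belong to [C], so two of them can be compared only after the
    supporting inequality is extended to the closure. *)
Lemma outer_normal_closure C xi nu : outer_normal C xi nu ->
  forall y, closure C y -> dot (y - xi) nu <= 0.
Proof.
move=> [_ H] y Cy; rewrite dotBl subr_le0.
apply: (@closure_le_cst C (dotr nu)) Cy; first exact: dotr_continuous.
by move=> z /H; rewrite dotBr subr_le0 !(dotC nu).
Qed.

Lemma outer_normal_unit C xi nu : outer_normal C xi nu -> dot nu nu = 1.
Proof. by move=> [[]]. Qed.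

Lemma outer_normal_boundary C xi nu : outer_normal C xi nu -> boundary C xi.
Proof. by move=> [[_ [g [_]]]]. Qed.

End LevelSets.

(** * Null sets of entrance points *)

Section NegligibleRays.
Context {R : realType}.
Local Notation S2 := (@surface_outer_measure R).
Implicit Types (C A : set 'rV[R]_3) (v xi nu : 'rV[R]_3).

Definition transversal C v : set 'rV[R]_3 :=
  [set xi | exists2 nu, outer_normal C xi nu & dot nu v != 0].

(* Comparing the supporting planes at two points x, y where |nu . v| >= 1/k
   bounds the component of y - x along v by k times its component across v. *)
Lemma supported_lipschitz C v k (x y nu nu' : 'rV[R]_3) (s : R) : 0 <= k ->
  dot v v = 1 -> s * s = 1 ->
  outer_normal C x nu -> outer_normal C y nu' ->
  1 <= k * (s * dot nu v) -> 1 <= k * (s * dot nu' v) ->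
  enorm (x - y) <= (k + 1) * enorm (x - y - dot (x - y) v *: v).
Proof.
move=> k0 v1 s1 nx ny kx ky.
have h2 : dot (x - y) nu' <= 0.
  by apply: (outer_normal_closure ny); case: (outer_normal_boundary nx).
have h1 : 0 <= dot (x - y) nu.
  rewrite -opprB dotNl oppr_ge0.
  by apply: (outer_normal_closure nx); case: (outer_normal_boundary ny).
move: (x - y) h1 h2 => d h1 h2.
set a := dot d v; set p := d - a *: v.
have dE : d = p + a *: v by rewrite subrK.
have pv : dot p v = 0 by rewrite /p dotBl dotZl v1 mulr1 subrr.
clearbody p a; subst d.
have dd : dot (p + a *: v) (p + a *: v) = dot p p + a ^+ 2.
  by rewrite !dotE v1 (dotC v) pv; ring.
have {}h1 : - a * dot nu v <= dot p nu.
  by move: h1; rewrite !dotE (dotC v); lra.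
have {}h2 : a * dot nu' v <= - dot p nu'.
  by move: h2; rewrite !dotE (dotC v); lra.
have p1 : `|dot p nu| <= enorm p := abs_dot_le _ (outer_normal_unit nx).
have p2 : `|dot p nu'| <= enorm p := abs_dot_le _ (outer_normal_unit ny).
have P0 := enorm_ge0 p.
have {}h1 : - (a * s) * (s * dot nu v) <= enorm p.
  have -> : - (a * s) * (s * dot nu v) = - a * dot nu v * (s * s) by ring.
  by rewrite s1 mulr1; apply: le_trans h1 (le_trans (ler_norm _) p1).
have {}h2 : (a * s) * (s * dot nu' v) <= enorm p.
  have -> : (a * s) * (s * dot nu' v) = a * dot nu' v * (s * s) by ring.
  rewrite s1 mulr1; apply: le_trans h2 (le_trans (ler_norm _) _).
  by rewrite normrN.
(* The sign of a s decides which of the two supporting planes bounds it: the one at y if it is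
   nonnegative, the one at x otherwise. *)
have {h1 h2} as2 : (a * s) ^+ 2 <= (k * enorm p) ^+ 2.
  have kp : 0 <= k * enorm p by rewrite mulr_ge0.
  have [sa|sa] := leP 0 (a * s).
    rewrite ler_pXn2r ?nnegrE//.
    apply: le_trans (ler_peMr sa ky) _.
    by rewrite mulrCA ler_wpM2l.
  have sa' : 0 <= - (a * s) by rewrite oppr_ge0 ltW.
  rewrite -sqrrN ler_pXn2r ?nnegrE//.
  apply: le_trans (ler_peMr sa' kx) _.
  by rewrite mulrCA ler_wpM2l.
have {}as2 : a ^+ 2 <= (k * enorm p) ^+ 2.
  by move: as2; rewrite exprMn [s ^+ 2]expr2 s1 mulr1.
rewrite enorm_le ?mulr_ge0 ?addr_ge0// dd -(sqr_enorm p).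
by have := mulr_ge0 k0 (sqr_ge0 (enorm p)); move: as2; rewrite !exprMn; lra.
Qed.

Lemma transversal_curve0 C v A (t : 'rV[R]_3 -> R) (a b K : R) :
  dot v v = 1 -> A `<=` transversal C v ->
  (forall x, A x -> a <= t x <= b) ->
  (forall x y, A x -> A y ->
    enorm (x - y - dot (x - y) v *: v) <= K * `|t x - t y|) ->
  S2 A = 0.
Proof.
move=> v1 AC tab tK.
(* The sign [s] separates the two sides of [C]: two boundary points on one line along [v] would
   violate any Lipschitz bound over the curve. *)
pose F (s : R) k := A `&` [set xi | exists2 nu, outer_normal C xi nu &
  1 <= k%:R * (s * dot nu v)].
have F0 s k : s * s = 1 -> S2 (F s k) = 0.
  move=> s1; apply: (@surface_area_curve0 _ _ t a b ((k%:R + 1) * K)).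
    by move=> x [/tab].
  move=> x y [Ax [nu nx kx]] [Ay [nu' ny ky]].
  apply: le_trans (supported_lipschitz _ v1 s1 nx ny kx ky) _ => //.
  by rewrite -mulrA ler_wpM2l ?addr_ge0 ?tK.
apply/eqP; rewrite eq_le outer_measure_ge0 andbT.
apply: (@le_trans _ _ (S2 (\bigcup_k F 1 k `|` \bigcup_k F (-1) k))).
  apply: le_outer_measure => x Ax; have [nu nx nv] := AC _ Ax.
  have key s : 0 < s * dot nu v -> (\bigcup_k F s k) x.
    move=> nv0; exists (Num.bound (s * dot nu v)^-1) => //; split=> //.
    exists nu => //; rewrite -ler_pdivrMr// mul1r; apply/ltW/archi_boundP.
    by rewrite invr_ge0 ltW.
  have [nv0|nv0] := ltP 0 (dot nu v); [left|right]; apply: key.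
    by rewrite mul1r.
  by rewrite mulN1r oppr_gt0 lt_neqAle nv.
apply: le_trans (outer_measureU2 _ _ _) _.
rewrite -[leRHS]adde0; apply: leeD.
  apply: le_trans (outer_measure_sigma_subadditive _ _) _.
  by rewrite eseries0// => k _ _; rewrite F0 ?mulr1.
apply: le_trans (outer_measure_sigma_subadditive _ _) _.
by rewrite eseries0// => k _ _; rewrite F0 // mulrNN mulr1.
Qed.

Lemma integral_null (D N : set (caratheodory_type S2))
    (f : caratheodory_type S2 -> R) :
  S2 N = 0%E -> (forall x, D x -> f x != 0 -> N x) ->
  (\int[@area_measure R]_(x in D) (f x)%:E = 0)%E.
Proof.
move=> N0 fN.
have key (g : caratheodory_type S2 -> \bar R) : (forall x, 0 <= g x)%E ->
    (forall x, (g x != 0)%E -> N x) ->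
    ereal_sup [set sintegral (@area_measure R) h
       | h in [set h : {nnsfun caratheodory_type S2 >-> R} |
           forall x, ((h x)%:E <= g x)%E]] = 0%E.
  move=> g0 gN; apply/eqP; rewrite eq_le; apply/andP; split; last first.
    by apply: ereal_sup_ubound; exists nnsfun0 => //; exact: sintegral0.
  apply: ge_ereal_sup => _ [h /= hg <-]; rewrite /sintegral fsbig1// => r _.
  have [->|r0] := eqVneq r 0; first by rewrite mul0e.
  transitivity (r%:E * 0)%E; last by rewrite mule0.
  congr (_ * _)%E.
  apply/eqP; rewrite eq_le; apply/andP; split; last exact: (@outer_measure_ge0 _ _ S2).
  rewrite -N0; apply: (@le_outer_measure _ _ S2) => x /= hx; apply: gN.
  have h0 : 0 <= h x by exact: fun_ge0.
  apply: contra_neq r0 => gx0; rewrite -hx; apply/eqP; rewrite eq_le h0 andbT.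
  by have := hg x; rewrite gx0 lee_fin.
have DN (x : caratheodory_type S2) : ((fun x => (f x)%:E) \_ D) x != 0%E -> N x.
  rewrite /patch; case: ifPn => [|_]; last by rewrite eqxx.
  by rewrite inE => Dx fx; apply: fN => //; move: fx; apply: contra_neq => ->.
rewrite /integral /= !key ?sube0// => x xn; apply: DN.
  by apply: contra_neq xn => h; rewrite funenegE h oppe0 maxxx.
by apply: contra_neq xn => h; rewrite funeposE h maxxx.
Qed.

(** [A] may have positive area: outside [N] every normal on it is orthogonal to [v], so the density
    of the flux vanishes there. *)
Lemma negligible_incoming C v (A N : set 'rV[R]_3) (P : 'rV[R]_3 -> Prop) :
  S2.-caratheodory A -> S2 N = 0 ->
  (forall xi, A xi -> transversal C v xi -> N xi) ->
  (forall xi, incoming C v xi -> ~ P xi -> A xi \/ N xi) ->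
  almost_every_incoming C v P.
Proof.
move=> mA N0 AN bad; exists (A `|` N); split.
- exact: caratheodory_measurable_setU mA (caratheodory_null N0).
- rewrite /incoming_flux; apply: (integral_null N0) => xi [AxiN [nu nP _]] nv.
  case: (pselect (N xi)) => // nN; apply: AN; first by case: AxiN.
  (* A nonzero density means that the chosen normal [normal_at] is itself a witness of
     transversality. *)
  exists (normal_at C xi); last by rewrite -oppr_eq0.
  by rewrite /normal_at; apply: xgetPex; exists nu.
- by move=> xi [inc nP]; exact: bad.
Qed.

End NegligibleRays.

(** * The body in coordinates *)

Section Shape.
Context {R : realType}.
Implicit Types x y z t : R.

(** On x = cap z one has x^2 + z^2 = (x + 1)^2, so this is the parabola with focus at the origin and
    directrix x = -1. *)
Definition cap z : R := (z ^+ 2 - 1) / 2.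

Definition solid x y z : Prop :=
  [/\ 1 <= z <= 2, - cap z <= x <= cap z & - cap z <= y <= cap z].

Definition core x y z : Prop :=
  [/\ 1 < z < 2, - cap z < x < cap z & - cap z < y < cap z].

Definition sheet x y z : Prop := [/\ z = 0, -2 <= x <= 2 & -2 <= y <= 2].

Definition shape x y z : Prop := solid x y z \/ sheet x y z.

Lemma core_shape x y z : core x y z -> shape x y z.
Proof.
case=> /andP[z1 z2] /andP[x1 x2] /andP[y1 y2]; left.
by split; apply/andP; split; exact: ltW.
Qed.

Lemma shape_core x y z (e : R) : 0 < e ->
  (forall t, `|t| < e -> shape (x + t) y z) ->
  (forall t, `|t| < e -> shape x (y + t) z) ->
  (forall t, `|t| < e -> shape x y (z + t)) -> core x y z.
Proof.
move=> e0 hx hy hz.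
(* Below e for the hypotheses, and at most 1/2 so that a vertical step from the sheet z = 0 cannot
   reach the solid, which starts at z = 1. *)
pose t := Num.min (e / 2) (1 / 2).
have t0 : 0 < t by rewrite lt_min; apply/andP; split; lra.
have t1 : t <= 1 / 2 by rewrite ge_min lexx orbT.
have te : `|t| < e.
  by rewrite gtr0_norm//; apply: (@le_lt_trans _ _ (e / 2)); [rewrite ge_min lexx|lra].
have te' : `|- t| < e by rewrite normrN.
have z1 : 1 <= z.
  have := hz _ te; have := hz 0; rewrite normr0 addr0 => /(_ e0).
  by case=> [[/andP[? ?] _ _]|[z0 _ _]] // [[/andP[? ?] _ _]|[? _ _]]; lra.
have S x' y' z' : 1 <= z' -> shape x' y' z' -> solid x' y' z'.
  by move=> z'1 [//|[? _ _]]; lra.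
have [/andP[_ z2] _ _] : solid x y (z + t) by apply: S (hz _ te); lra.
have [_ /andP[_ x2] _] := S _ _ _ z1 (hx _ te).
have [_ /andP[x1 _] _] := S _ _ _ z1 (hx _ te').
have [_ _ /andP[_ y2]] := S _ _ _ z1 (hy _ te).
have [_ _ /andP[y1 _]] := S _ _ _ z1 (hy _ te').
(* Both x + t and x - t fit between -cap z and cap z, so cap z is positive, and hence z > 1. *)
have zc : 0 < cap z by lra.
split; apply/andP; split; try lra.
move: zc; rewrite /cap; nra.
Qed.

Lemma wall_shape x y z : 1 < z < 2 -> - cap z < y < cap z -> 0 < x ->
  (shape x y z /\ ~ core x y z) <-> x - cap z = 0.
Proof.
move=> /andP[z1 z2] /andP[y1 y2] x0; split.
  move=> [[[_ /andP[xl xr] _]|[? _ _]]]; last lra.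
  move=> nc; apply/eqP; rewrite subr_eq0 eq_le xr /= leNgt; apply/negP => xlt.
  by apply: nc; split; apply/andP; split=> //; lra.
move=> xc; split; first by left; split; apply/andP; split; lra.
by case=> _ /andP[_ ?] _; lra.
Qed.

Lemma shapeNx x y z : shape (- x) y z <-> shape x y z.
Proof.
rewrite /shape /solid /sheet; split=> -[[? /andP[? ?] ?]|[? /andP[? ?] ?]];
  by [left; split=> //; lra|right; split=> //; lra].
Qed.

Lemma coreNx x y z : core (- x) y z <-> core x y z.
Proof. by rewrite /core; split=> -[? /andP[? ?] ?]; split=> //; lra. Qed.

Lemma shape_swap x y z : shape x y z <-> shape y x z.
Proof. by split=> -[[? ? ?]|[? ? ?]]; [left|right|left|right]. Qed.

Lemma sheet_shape x y z : -1 < z < 1 -> -2 < x < 2 -> -2 < y < 2 ->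
  (shape x y z /\ ~ core x y z) <-> z = 0.
Proof.
move=> /andP[z1 z2] /andP[x1 x2] /andP[y1 y2]; split.
  by move=> [[[/andP[? ?] _ _]|[]]] //; lra.
move=> z0; split; first by right; split=> //; lra.
by case=> /andP[? ?] _ _; lra.
Qed.

End Shape.

(** * Topology and unit normals of the body *)

Section Body.
Context {R : realType}.
Implicit Types (p q w : 'rV[R]_3) (f g : 'rV[R]_3 -> R^o).

Definition mirror (e1 e2 e3 : 'rV[R]_3) : set 'rV[R]_3 :=
  [set p | shape (dot p e1) (dot p e2) (dot p e3)].

Lemma mirror_swap (e1 e2 e3 : 'rV[R]_3) : mirror e1 e2 e3 = mirror e2 e1 e3.
Proof. by apply/seteqP; split=> p; rewrite /mirror /= shape_swap. Qed.

Lemma Ck_cap k w : Ck k (fun p => cap (dot p w) : R^o).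
Proof.
apply: eq_Ck (CkD (CkM (CkM (Ck_dotr k w) (Ck_dotr k w)) (Ck_cst k (2^-1 : R^o)))
  (Ck_cst k (- 2^-1 : R^o))) => p.
by rewrite /cap /dotr /=; field.
Qed.

Lemma Ck_opp k f : Ck k f -> Ck k (fun p => - f p).
Proof.
by move=> fC; apply: eq_Ck (CkM (Ck_cst k (-1 : R^o)) fC) => p; rewrite mulN1r.
Qed.

Lemma closed_le_fun f g : continuous f -> continuous g ->
  closed [set p | f p <= g p].
Proof.
move=> fc gc; rewrite (_ : [set p | _] = [set p | f p - g p <= 0]); last first.
  by apply/seteqP; split=> p /=; rewrite subr_le0.
apply: (@closed_le_cst R (fun p => f p - g p)).
exact: (@CkD R 3 R^o 0 f (fun p => - g p) fc (@Ck_opp 0 g gc)).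
Qed.

Lemma open_lt_fun f g : continuous f -> continuous g ->
  open [set p | f p < g p].
Proof.
move=> fc gc; rewrite (_ : [set p | _] = [set p | f p - g p < 0]); last first.
  by apply/seteqP; split=> p /=; rewrite subr_lt0.
apply: (@open_lt_cst R (fun p => f p - g p)).
exact: (@CkD R 3 R^o 0 f (fun p => - g p) fc (@Ck_opp 0 g gc)).
Qed.

Let cstc (c : R) : continuous (fun _ : 'rV[R]_3 => c : R^o) := @Ck_cst R 3 R^o 0 c.
Let capc w : continuous (fun p => cap (dot p w) : R^o) := Ck_cap 0 w.
Let ncapc w : continuous (fun p => - cap (dot p w) : R^o) := Ck_opp (Ck_cap 0 w).
Let dotc w : continuous (fun p => dot p w : R^o) := @dotr_continuous R 3 w.

Lemma mirror_closed (e1 e2 e3 : 'rV[R]_3) : closed (mirror e1 e2 e3).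
Proof.
rewrite (_ : mirror _ _ _ =
  ([set p | 1 <= dot p e3] `&` [set p | dot p e3 <= 2] `&`
  [set p | - cap (dot p e3) <= dot p e1] `&` [set p | dot p e1 <= cap (dot p e3)] `&`
  [set p | - cap (dot p e3) <= dot p e2] `&` [set p | dot p e2 <= cap (dot p e3)]) `|`
  ([set p | 0 <= dot p e3] `&` [set p | dot p e3 <= 0] `&`
  [set p | -2 <= dot p e1] `&` [set p | dot p e1 <= 2] `&`
  [set p | -2 <= dot p e2] `&` [set p | dot p e2 <= 2])).
  apply: closedU; repeat apply: closedI; apply: closed_le_fun => //.
apply/seteqP; split=> p /=.
  case=> [[/andP[? ?] /andP[? ?] /andP[? ?]]|[-> /andP[? ?] /andP[? ?]]]; [left|right];
  by do !split.
case=> -[[[[[? ?] ?] ?] ?] ?]; [left|right]; split; try exact/andP.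
by apply/eqP; rewrite eq_le; apply/andP.
Qed.

Lemma core_open (e1 e2 e3 : 'rV[R]_3) : open [set p | core (dot p e1) (dot p e2) (dot p e3)].
Proof.
rewrite (_ : [set p | _] =
  ([set p | 1 < dot p e3] `&` [set p | dot p e3 < 2] `&`
  [set p | - cap (dot p e3) < dot p e1] `&` [set p | dot p e1 < cap (dot p e3)] `&`
  [set p | - cap (dot p e3) < dot p e2] `&` [set p | dot p e2 < cap (dot p e3)])).
  repeat apply: openI; apply: open_lt_fun => //.
apply/seteqP; split=> p /=.
  by case=> /andP[? ?] /andP[? ?] /andP[? ?]; do !split.
by case=> -[[[[? ?] ?] ?] ?] ?; split; exact/andP.
Qed.

Lemma interior_line (A : set 'rV[R]_3) p (w : 'rV[R]_3) : interior A p ->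
  exists2 e : R, 0 < e & forall t, `|t| < e -> A (p + t *: w).
Proof.
move=> Ap.
have : (fun t : R => p + t *: w) t @[t --> (0 : R)] --> p + 0 *: w.
  apply: cvgD; first exact: cvg_cst.
  by apply: (@cvgZr_tmp R _ R (nbhs (0 : R))); exact: cvg_id.
rewrite scale0r addr0 => /(_ _ Ap) /nbhs_ballP[e /= e0 eA]; exists e => // t te.
by apply: eA; rewrite /ball /= sub0r normrN.
Qed.

Context {e1 e2 e3 : 'rV[R]_3} (o : orthonormal e1 e2 e3).

Lemma mirror_interior :
  interior (mirror e1 e2 e3) = [set p | core (dot p e1) (dot p e2) (dot p e3)].
Proof.
apply/seteqP; split; last first.
  by rewrite -open_subsetE; [move=> p /core_shape|exact: core_open].
case: o => h1 h2 h3 h12 h13 h23 p ip.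
have [a a0 ha] := interior_line e1 ip; have [b b0 hb] := interior_line e2 ip.
have [c c0 hc] := interior_line e3 ip.
apply: (@shape_core _ _ _ _ (Num.min a (Num.min b c))).
- by rewrite !lt_min a0 b0.
- move=> t; rewrite !lt_min => /andP[/ha + _].
  by rewrite /mirror /= !dotE h1 h12 h13 mulr1 !mulr0 !addr0.
- move=> t; rewrite !lt_min => /andP[_ /andP[/hb + _]].
  by rewrite /mirror /= !dotE h2 (dotC e2 e1) h12 h23 mulr1 !mulr0 !addr0.
- move=> t; rewrite !lt_min => /andP[_ /andP[_ /hc]].
  by rewrite /mirror /= !dotE h3 (dotC e3 e1) (dotC e3 e2) h13 h23 mulr1 !mulr0 !addr0.
Qed.

Lemma mirror_closure : closure (mirror e1 e2 e3) = mirror e1 e2 e3.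
Proof. by rewrite -(proj1 (closure_id _) (@mirror_closed _ _ _)). Qed.

Lemma mirror_boundaryE p : boundary (mirror e1 e2 e3) p <->
  shape (dot p e1) (dot p e2) (dot p e3) /\
  ~ core (dot p e1) (dot p e2) (dot p e3).
Proof. by rewrite /boundary mirror_closure mirror_interior. Qed.

Lemma mirror_bounded : bounded_set (mirror e1 e2 e3).
Proof.
exists (2 * `|e1| + 2 * `|e2| + 2 * `|e3|); split; first exact: num_real.
move=> M /ltW MM p pB; apply: le_trans MM; rewrite (frameE o p).
have [h1 h2 h3] : [/\ `|dot p e1| <= 2, `|dot p e2| <= 2 & `|dot p e3| <= 2].
  case: pB => [[/andP[? ?] /andP[? ?] /andP[? ?]]|[z0 /andP[? ?] /andP[? ?]]].
    have c2 : cap (dot p e3) <= 2 by rewrite /cap; nra.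
    by rewrite !ler_norml; split; apply/andP; split; lra.
  by rewrite !ler_norml z0; split; apply/andP; split; lra.
apply: le_trans (ler_normD _ _) _; apply: lerD; last by rewrite normrZ ler_wpM2r.
by apply: le_trans (ler_normD _ _) _; apply: lerD; rewrite normrZ ler_wpM2r.
Qed.

(** [cap] has derivative z, so s e1 - z e3 is the gradient of s x - cap z; the sign s = 1 or -1
    selects the wall. *)
Definition wall_normal (e1 e3 : 'rV[R]_3) (s z : R) : 'rV[R]_3 :=
  (Num.sqrt (1 + z ^+ 2))^-1 *: (s *: e1 - z *: e3).

Lemma gradientE f x w : differentiable f x -> (forall v, 'D_v f x = dot v w) ->
  gradient f x = w.
Proof. by move=> fd fw; apply/rowP => i; rewrite mxE fw dotC dot_delta. Qed.

Definition wall s p : R^o := s * dot p e1 - cap (dot p e3).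

Lemma wallE s : wall s = fun p =>
  (s : R^o) * dotr e1 p + ((- 2^-1 : R^o) * (dotr e3 p * dotr e3 p) + 2^-1).
Proof. by apply/funext => p; rewrite /wall /cap /dotr; field. Qed.

Lemma wall_smooth s : smooth (wall s).
Proof.
move=> k; rewrite wallE; apply: CkD.
  exact: (CkM (Ck_cst k (s : R^o)) (Ck_dotr k e1)).
apply: CkD; last exact: (Ck_cst k (2^-1 : R^o)).
exact: (CkM (Ck_cst k (- 2^-1 : R^o)) (CkM (Ck_dotr k e3) (Ck_dotr k e3))).
Qed.

Lemma derive_wall s p v : 'D_v (wall s) p = dot v (s *: e1 - dot p e3 *: e3).
Proof.
have D w := Ck_dotr 1 w; have C (c : R) := Ck_cst 1 (c : R^o).
rewrite wallE deriveD_Ck ?deriveD_Ck ?deriveM_Ck ?derive_cst ?derive_dotr //;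
  try by repeat (apply: CkD || apply: CkM).
by rewrite !dotE /dotr; field.
Qed.

Lemma sqr1_sign (s : R) : s * s = 1 -> s = 1 \/ s = -1.
Proof.
move=> ss; have : (s - 1) * (s + 1) == 0.
  have -> : (s - 1) * (s + 1) = s * s - 1 by ring.
  by rewrite ss subrr.
by rewrite mulf_eq0 subr_eq0 addr_eq0 => /orP[] /eqP ->; [left|right].
Qed.

Lemma shape_sign (s x y z : R) : s * s = 1 ->
  (shape (s * x) y z <-> shape x y z) /\ (core (s * x) y z <-> core x y z).
Proof.
move=> /sqr1_sign[] ->; first by rewrite mul1r.
by rewrite mulN1r; split; [exact: shapeNx|exact: coreNx].
Qed.

Lemma mirror_wall_normal (s : R) p : s * s = 1 -> 1 < dot p e3 < 2 ->
  - cap (dot p e3) < dot p e2 < cap (dot p e3) -> dot p e1 = s * cap (dot p e3) ->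
  unit_normal (boundary (mirror e1 e2 e3)) p (wall_normal e1 e3 s (dot p e3)).
Proof.
move=> ss /andP[z1 z2] /andP[y1 y2] xE.
have sx : s * dot p e1 = cap (dot p e3) by rewrite xE mulrA ss mul1r.
pose w := s *: e1 - dot p e3 *: e3.
have ww : dot w w = 1 + dot p e3 ^+ 2.
  case: o => h1 h2 h3 h12 h13 h23; transitivity (s * s + dot p e3 ^+ 2); last by rewrite ss.
  by rewrite /w !dotE (dotC e3 e1) h1 h3 h13; ring.
have z0 : 0 < 1 + dot p e3 ^+ 2 by rewrite ltr_wpDr ?sqr_ge0.
have gw : gradient (wall s) p = w.
  apply: gradientE; last by move=> v; rewrite derive_wall.
  by have [] := wall_smooth s 1.
(* On this open set the boundary is the single wall s x = cap z: the last factor cuts off the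
   opposite wall, the others the remaining faces. *)
have O : open ([set q | 1 < dot q e3] `&` [set q | dot q e3 < 2] `&`
  [set q | - cap (dot q e3) < dot q e2] `&` [set q | dot q e2 < cap (dot q e3)] `&`
  [set q | 0 < dot q (s *: e1)]).
  by repeat apply: openI; apply: open_lt_fun => //; exact: dotr_continuous.
have near_p : \forall q \near p, boundary (mirror e1 e2 e3) q <-> wall s q = 0.
  apply: filterS (open_nbhs_nbhs (conj O _)) => [q|]; last first.
    by do !split=> //=; rewrite dotZr sx /cap; nra.
  move=> [[[[q1 q2] q3] q4]] /=; rewrite dotZr => q5; rewrite mirror_boundaryE.
  have [<- <-] := shape_sign (dot q e1) (dot q e2) (dot q e3) ss.
  by apply: wall_shape => //; exact/andP.
split.
  rewrite /wall_normal -/w dotZl dotZr ww mulrA -expr2 exprVn sqr_sqrtr ?(ltW z0)//.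
  by rewrite mulVf// gt_eqF.
exists (wall s); split=> //.
- exact: wall_smooth.
- by apply: (nbhs_singleton near_p).2; rewrite /wall sx subrr.
- by rewrite gw; apply: contraTneq z0 => w0; rewrite -ww w0 dot0l ltxx.
- by rewrite gw; exists (Num.sqrt (1 + dot p e3 ^+ 2))^-1.
Qed.

Lemma mirror_sheet_normal p : dot p e3 = 0 -> -2 < dot p e1 < 2 ->
  -2 < dot p e2 < 2 -> unit_normal (boundary (mirror e1 e2 e3)) p e3.
Proof.
move=> z0 /andP[x1 x2] /andP[y1 y2].
have gw : gradient (dotr e3) p = e3.
  apply: gradientE; last by move=> v; rewrite derive_dotr.
  exact: differentiable_dotr.
have O : open ([set q | -1 < dot q e3] `&` [set q | dot q e3 < 1] `&`
  [set q | -2 < dot q e1] `&` [set q | dot q e1 < 2] `&`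
  [set q | -2 < dot q e2] `&` [set q | dot q e2 < 2]).
  by repeat apply: openI; apply: open_lt_fun => //; exact: dotr_continuous.
have near_p : \forall q \near p, boundary (mirror e1 e2 e3) q <-> dotr e3 q = 0.
  apply: filterS (open_nbhs_nbhs (conj O _)) => [q|]; last first.
    by do !split=> //=; rewrite z0; lra.
  move=> [[[[[q1 q2] q3] q4] q5] q6]; rewrite mirror_boundaryE.
  by apply: sheet_shape; exact/andP.
have e30 : e3 != 0.
  by apply: contraTneq (@ltr01 R) => e0; case: o => _ _ <- _ _ _; rewrite e0 dot0l ltxx.
split; first by case: o.
exists (dotr e3); split=> //.
- by move=> k; exact: Ck_dotr.
- exact: (nbhs_singleton near_p).2.
- by rewrite gw.
- by rewrite gw; exists 1; rewrite scale1r.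
Qed.

End Body.

(** * Parametrized faces *)

Section Patches.
Context {R : realType}.
Implicit Types (p q v : 'rV[R]_2) (s c r : R).

Definition rise p : R^o := p 0 0 + 2^-1 * (p 0 0 * p 0 0).

(** The edge [p 0 0 = 0] collapses to the apex (0, 0, 1) of the solid, where the four walls meet. *)
Definition wall_patch (a b c : 'rV[R]_3) s p : 'rV[R]_3 :=
  point a b c (s * rise p) ((2 * p 0 1 - 1) * rise p) (1 + p 0 0).

Definition flat_patch (a b c : 'rV[R]_3) r z p : 'rV[R]_3 :=
  point a b c (r * (2 * p 0 0 - 1)) (r * (2 * p 0 1 - 1)) z.

Lemma rise_cap p : rise p = cap (1 + p 0 0).
Proof. by rewrite /rise /cap; field. Qed.

Lemma rise_gt0 p : open_square p -> 0 < rise p.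
Proof. by move=> /(_ 0) /andP[? _]; rewrite /rise; nra. Qed.

Lemma rV2_eq p q : p 0 0 = q 0 0 -> p 0 1 = q 0 1 -> p = q.
Proof.
move=> h0 h1; apply/rowP => -[[|[|//]] i].
  by rewrite (_ : Ordinal i = 0)//; apply/val_inj.
by rewrite (_ : Ordinal i = 1)//; apply/val_inj.
Qed.

Lemma Ck_rise k : Ck k rise.
Proof.
apply: CkD; first exact: Ck_coord.
exact: (CkM (Ck_cst k (2^-1 : R^o)) (CkM (Ck_coord k 0) (Ck_coord k 0))).
Qed.

Lemma Ck_affine k (a b : R) i : Ck k (fun p => a + b * p 0 i : R^o).
Proof.
apply: (CkD (Ck_cst k (a : R^o))).
exact: (CkM (Ck_cst k (b : R^o)) (Ck_coord k i)).
Qed.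

Definition pt_map (a b c : 'rV[R]_3) (f g h : 'rV[R]_2 -> R^o) p :=
  point a b c (f p) (g p) (h p).

Lemma pt_map_smooth (a b c : 'rV[R]_3) f g h :
  smooth f -> smooth g -> smooth h -> smooth (pt_map a b c f g h).
Proof. by move=> F G H k; apply: CkD; [apply: CkD|]; apply: CkZ. Qed.

Lemma derive_coord p v i : 'D_v (fun q => q 0 i : R^o) p = v 0 i.
Proof.
rewrite (_ : (fun q => _) = dotr (delta_mx 0 i)).
  by rewrite derive_dotr dot_delta.
by apply/funext => q; rewrite /dotr dot_delta.
Qed.

Lemma derive_affine (a b : R) i p v : 'D_v (fun p => a + b * p 0 i : R^o) p = b * v 0 i.
Proof.
have X := @Ck_coord R 2 1 i; have A := @Ck_cst R 2 R^o 1 a.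
have B := @Ck_cst R 2 R^o 1 b.
rewrite (deriveD_Ck _ _ A (CkM B X)) (deriveM_Ck _ _ B X) derive_coord.
by rewrite !derive_cst mulr0 addr0 add0r.
Qed.

Lemma derive_rise p v : 'D_v rise p = (1 + p 0 0) * v 0 0.
Proof.
have X := @Ck_coord R 2 1 0; have H := @Ck_cst R 2 R^o 1 2^-1.
rewrite (deriveD_Ck _ _ X (CkM H (CkM X X))) (deriveM_Ck _ _ H (CkM X X)).
by rewrite (deriveM_Ck _ _ X X) derive_coord derive_cst; field.
Qed.

Context {a b c : 'rV[R]_3} (o : orthonormal a b c).

(** Full rank means that no nonzero direction has zero derivative, which the frame turns into one
    equation per coordinate. *)
Lemma pt_map_rank f g h p : smooth f -> smooth g -> smooth h ->
  (forall v, 'D_v f p = 0 -> 'D_v g p = 0 -> 'D_v h p = 0 -> v = 0) ->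
  \rank ('J (pt_map a b c f g h) p) = 2%N.
Proof.
move=> F G H inj; have S := pt_map_smooth a b c F G H.
apply/eqP; change (row_free ('J (pt_map a b c f g h) p)).
apply: inj_row_free => v.
rewrite -deriveEjacobian; last by have [] := S 1.
have -> : 'D_v (pt_map a b c f g h) p = point a b c ('D_v f p) ('D_v g p) ('D_v h p).
  rewrite [LHS]deriveD_Ck; [|by apply: CkD; apply: CkZ|by apply: CkZ].
  rewrite deriveD_Ck; [|by apply: CkZ|by apply: CkZ].
  have [[dF _] [dG _] [dH _]] := And3 (F 1) (G 1) (H 1).
  by rewrite !derive_scaler.
move=> v0; apply: inj.
- by rewrite -(dot_pt1 o ('D_v f p) ('D_v g p) ('D_v h p)) v0 dot0l.
- by rewrite -(dot_pt2 o ('D_v f p) ('D_v g p) ('D_v h p)) v0 dot0l.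
- by rewrite -(dot_pt3 o ('D_v f p) ('D_v g p) ('D_v h p)) v0 dot0l.
Qed.

Lemma wall_patchE s : wall_patch a b c s = pt_map a b c (fun p => s * rise p)
  (fun p => (-1 + 2 * p 0 1) * rise p) (fun p => 1 + 1 * p 0 0).
Proof.
by apply/funext => p; rewrite /pt_map /wall_patch; congr point; ring.
Qed.

Lemma flat_patchE r z : flat_patch a b c r z = pt_map a b c
  (fun p => - r + (2 * r) * p 0 0) (fun p => - r + (2 * r) * p 0 1) (fun=> z).
Proof.
by apply/funext => p; rewrite /pt_map /flat_patch; congr point; ring.
Qed.

Let sm_x s : smooth (fun p => s * rise p : R^o).
Proof. by move=> k; exact: (CkM (Ck_cst k (s : R^o)) (Ck_rise k)). Qed.

Let sm_y : smooth (fun p => (-1 + 2 * p 0 1) * rise p : R^o).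
Proof. by move=> k; exact: (CkM (Ck_affine k (-1) 2 1) (Ck_rise k)). Qed.

Let sm_z : smooth (fun p => 1 + 1 * p 0 0 : R^o).
Proof. by move=> k; exact: Ck_affine. Qed.

Let sm_a r i : smooth (fun p => - r + (2 * r) * p 0 i : R^o).
Proof. by move=> k; exact: Ck_affine. Qed.

Let sm_c z : smooth (fun _ : 'rV[R]_2 => z : R^o).
Proof. by move=> k; exact: Ck_cst. Qed.

Lemma wall_patch_smooth s : smooth (wall_patch a b c s).
Proof. by rewrite wall_patchE; exact: pt_map_smooth. Qed.

Lemma flat_patch_smooth r z : smooth (flat_patch a b c r z).
Proof. by rewrite flat_patchE; exact: pt_map_smooth. Qed.

Lemma wall_patch_rank s p : open_square p -> \rank ('J (wall_patch a b c s) p) = 2%N.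
Proof.
move=> op; have r0 := rise_gt0 op.
rewrite wall_patchE; apply: pt_map_rank => // v _.
rewrite (deriveM_Ck _ _ (Ck_affine 1 (-1) 2 1) (Ck_rise 1)) derive_rise !derive_affine.
rewrite mul1r => + v0; rewrite v0 !mulr0 add0r => h.
apply: rV2_eq; rewrite [RHS]mxE// .
by move/eqP: h; rewrite !mulf_eq0 (gt_eqF r0) pnatr_eq0 /= => /eqP.
Qed.

Lemma flat_patch_rank r z p : r != 0 -> \rank ('J (flat_patch a b c r z) p) = 2%N.
Proof.
move=> r0; rewrite flat_patchE; apply: pt_map_rank => // v.
rewrite !derive_affine => h1 h2 _.
by apply: rV2_eq; rewrite [RHS]mxE; [move/eqP: h1|move/eqP: h2];
  rewrite !mulf_eq0 (negbTE r0) pnatr_eq0 /= => /eqP.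
Qed.

Lemma wall_patch_inj s s' p q : open_square p ->
  wall_patch a b c s p = wall_patch a b c s' q -> s = s' /\ p = q.
Proof.
move=> op /[dup] /(congr1 (dotr a)) /[swap] /[dup] /(congr1 (dotr b)).
move=> /[swap] /(congr1 (dotr c)); rewrite /dotr !(dot_pt o) => h3 h2 h1.
have r0 := rise_gt0 op.
have h0 : p 0 0 = q 0 0 by lra.
have rE : rise q = rise p by rewrite /rise h0.
move: h1 h2; rewrite rE => /(mulIf (lt0r_neq0 r0)) -> /(mulIf (lt0r_neq0 r0)) h2.
by split=> //; apply: rV2_eq => //; lra.
Qed.

(** At equal height, adjacent walls agree only if 2 p_1 - 1 = s', that is 1 or -1, which puts [p] on
    an edge of the square. *)
Lemma wall_patch_cross s s' p q : s' * s' = 1 -> open_square p ->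
  wall_patch a b c s p != wall_patch b a c s' q.
Proof.
move=> ss op; apply/eqP => /[dup] /(congr1 (dotr b)) /[swap].
move=> /(congr1 (dotr c)); have o' := orthonormal_swap o.
rewrite /dotr !(dot_pt o) !(dot_pt o') => h3 h2.
have r0 := rise_gt0 op; have h0 : p 0 0 = q 0 0 by lra.
have rE : rise q = rise p by rewrite /rise h0.
move: h2; rewrite rE => /(mulIf (lt0r_neq0 r0)) h2.
by have /andP[? ?] := op 1; move: ss; rewrite -h2; nra.
Qed.

Lemma wall_patch_flat s r z p q : z = 0 \/ z = 2 -> open_square p ->
  wall_patch a b c s p != flat_patch a b c r z q.
Proof.
move=> z02 op; apply/eqP => /(congr1 (dotr c)); rewrite /dotr !(dot_pt o).
by have /andP[? ?] := op 0; case: z02 => ->; lra.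
Qed.

(** The sheet lies below every wall. The top face has half-width cap 2 = 3/2 and meets a wall only
    at z = 2, where 2 p_0 - 1 = s puts [p] on an edge. *)
Lemma flat_patch_wall s r z p q : z = 0 \/ z = 2 /\ r = 3 / 2 -> s * s = 1 ->
  open_square p -> closed_square q ->
  flat_patch a b c r z p != wall_patch a b c s q.
Proof.
move=> zr ss op cq; apply/eqP => /[dup] /(congr1 (dotr a)) /[swap].
move=> /(congr1 (dotr c)); rewrite /dotr !(dot_pt o) => h3 h1.
have /andP[? ?] := cq 0; case: zr => [z0|[z2 r2]]; first by lra.
have q0 : q 0 0 = 1 by lra.
move: h1; rewrite /rise q0 r2 => h1.
have sE : s = 2 * p 0 0 - 1 by lra.
by have /andP[? ?] := op 0; move: ss; rewrite sE; nra.
Qed.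

Lemma flat_patch_inj r r' z z' p q : (z = z' -> r = r') -> r != 0 ->
  flat_patch a b c r z p = flat_patch a b c r' z' q -> z = z' /\ p = q.
Proof.
move=> zr r0 /[dup] /(congr1 (dotr a)) /[swap] /[dup] /(congr1 (dotr b)).
move=> /[swap] /(congr1 (dotr c)); rewrite /dotr !(dot_pt o) => h3.
rewrite -(zr h3) => /(mulfI r0) h2 /(mulfI r0) h1.
by split=> //; apply: rV2_eq; lra.
Qed.

End Patches.

(** * The six faces and their disjointness *)

Section MirrorSurface.
Context {R : realType} {e1 e2 e3 : 'rV[R]_3} (o : orthonormal e1 e2 e3).
Let o' := orthonormal_swap o.

(** Four walls, the top face and the sheet. The solid has no bottom face, since its section shrinks
    to a point at z = 1; the sheet has no interior, so it is all boundary and a single patch covers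
    it. *)
Definition mirror_patch (i : 'I_6) : 'rV[R]_2 -> 'rV[R]_3 :=
  match val i with
  | 0 => wall_patch e1 e2 e3 1
  | 1 => wall_patch e1 e2 e3 (-1)
  | 2 => wall_patch e2 e1 e3 1
  | 3 => wall_patch e2 e1 e3 (-1)
  | 4 => flat_patch e1 e2 e3 (3 / 2) 2
  | _ => flat_patch e1 e2 e3 2 0
  end.

(** Exchanging the two parameters exchanges [e1] and [e2], so the separation results for the walls
    across [e1] also serve those across [e2]. *)
Lemma flat_patch_swap r z (p : 'rV[R]_2) : exists q : 'rV[R]_2,
  [/\ flat_patch e1 e2 e3 r z p = flat_patch e2 e1 e3 r z q,
   open_square p -> open_square q & closed_square p -> closed_square q].
Proof.
exists (\row_i if i == 0 then p 0 1 else p 0 0); split.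
- by rewrite /flat_patch /point !mxE /=; congr (_ + _); exact: addrC.
- by move=> op i; rewrite mxE; case: ifP.
- by move=> op i; rewrite mxE; case: ifP.
Qed.

Lemma mirror_patch_inj i j p q : open_square p -> closed_square q ->
  mirror_patch i p = mirror_patch j q -> i = j /\ p = q.
Proof.
move=> op cq.
have ss : (1 : R) * 1 = 1 by rewrite mulr1.
have nn : (-1 : R) * -1 = 1 by rewrite mulrNN mulr1.
have pm : (1 : R) <> -1 by lra.
have mp : (-1 : R) <> 1 by lra.
have n20 : (2 : R) <> 0 by lra.
have n02 : (0 : R) <> 2 by lra.
have r1 : (3 / 2 : R) != 0 by rewrite gt_eqF//; lra.
have r2 : (2 : R) != 0 by rewrite gt_eqF//; lra.
have z0 : (0 : R) = 0 \/ (0 : R) = 2 by left.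
have z2 : (2 : R) = 0 \/ (2 : R) = 2 by right.
have f0 : (0 : R) = 0 \/ (0 : R) = 2 /\ (2 : R) = 3 / 2 by left.
have f2 : (2 : R) = 0 \/ (2 : R) = 2 /\ (3 / 2 : R) = 3 / 2 by right.
have same (a b c : 'rV[R]_3) s k (h h' : (k < 6)%N) : orthonormal a b c ->
    wall_patch a b c s p = wall_patch a b c s q -> Ordinal h = Ordinal h' /\ p = q.
  by move=> O /(wall_patch_inj O op)[_ ->]; split=> //; exact/val_inj.
have opposite (a b c : 'rV[R]_3) s s' (P : Prop) : orthonormal a b c -> s <> s' ->
    wall_patch a b c s p = wall_patch a b c s' q -> P.
  by move=> O sN /(wall_patch_inj O op)[/sN].
have cross (a b c : 'rV[R]_3) s s' (P : Prop) : orthonormal a b c -> s' * s' = 1 ->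
    wall_patch a b c s p = wall_patch b a c s' q -> P.
  by move=> O s1 /eqP; rewrite (negbTE (wall_patch_cross O _ _ s1 op)).
have wallflat s r z (P : Prop) : z = 0 \/ z = 2 ->
    wall_patch e1 e2 e3 s p = flat_patch e1 e2 e3 r z q -> P.
  by move=> zz /eqP; rewrite (negbTE (wall_patch_flat o _ _ _ zz op)).
have wallflat' s r z (P : Prop) : z = 0 \/ z = 2 ->
    wall_patch e2 e1 e3 s p = flat_patch e1 e2 e3 r z q -> P.
  move=> zz; have [q' [-> _ _]] := flat_patch_swap r z q.
  by move=> /eqP; rewrite (negbTE (wall_patch_flat o' _ _ _ zz op)).
have flatwall s r z (P : Prop) : z = 0 \/ z = 2 /\ r = 3 / 2 -> s * s = 1 ->
    flat_patch e1 e2 e3 r z p = wall_patch e1 e2 e3 s q -> P.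
  by move=> zz s1 /eqP; rewrite (negbTE (flat_patch_wall o zz s1 op cq)).
have flatwall' s r z (P : Prop) : z = 0 \/ z = 2 /\ r = 3 / 2 -> s * s = 1 ->
    flat_patch e1 e2 e3 r z p = wall_patch e2 e1 e3 s q -> P.
  move=> zz s1; have [p' [-> /(_ op) op' _]] := flat_patch_swap r z p.
  by move=> /eqP; rewrite (negbTE (flat_patch_wall o' zz s1 op' cq)).
have sameflat r z k (h h' : (k < 6)%N) : r != 0 ->
    flat_patch e1 e2 e3 r z p = flat_patch e1 e2 e3 r z q ->
    Ordinal h = Ordinal h' /\ p = q.
  by move=> r0 /(flat_patch_inj o (fun=> erefl) r0)[_ ->]; split=> //; exact/val_inj.
have otherflat r r' z z' (P : Prop) : z <> z' ->
    flat_patch e1 e2 e3 r z p = flat_patch e1 e2 e3 r' z' q -> P.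
  by move=> zz /(congr1 (dotr e3)); rewrite /dotr !(dot_pt o) => /zz.
case: i => -[|[|[|[|[|[|//]]]]]] hi; case: j => -[|[|[|[|[|[|//]]]]]] hj; rewrite /mirror_patch /=.
- exact: (same _ _ _ _ _ _ _ o).
- exact: (opposite _ _ _ _ _ _ o pm).
- exact: (cross _ _ _ _ _ _ o ss).
- exact: (cross _ _ _ _ _ _ o nn).
- exact: (wallflat _ _ _ _ z2).
- exact: (wallflat _ _ _ _ z0).
- exact: (opposite _ _ _ _ _ _ o mp).
- exact: (same _ _ _ _ _ _ _ o).
- exact: (cross _ _ _ _ _ _ o ss).
- exact: (cross _ _ _ _ _ _ o nn).
- exact: (wallflat _ _ _ _ z2).
- exact: (wallflat _ _ _ _ z0).
- exact: (cross _ _ _ _ _ _ o' ss).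
- exact: (cross _ _ _ _ _ _ o' nn).
- exact: (same _ _ _ _ _ _ _ o').
- exact: (opposite _ _ _ _ _ _ o' pm).
- exact: (wallflat' _ _ _ _ z2).
- exact: (wallflat' _ _ _ _ z0).
- exact: (cross _ _ _ _ _ _ o' ss).
- exact: (cross _ _ _ _ _ _ o' nn).
- exact: (opposite _ _ _ _ _ _ o' mp).
- exact: (same _ _ _ _ _ _ _ o').
- exact: (wallflat' _ _ _ _ z2).
- exact: (wallflat' _ _ _ _ z0).
- exact: (flatwall _ _ _ _ f2 ss).
- exact: (flatwall _ _ _ _ f2 nn).
- exact: (flatwall' _ _ _ _ f2 ss).
- exact: (flatwall' _ _ _ _ f2 nn).
- exact: (sameflat _ _ _ _ _ r1).
- exact: (otherflat _ _ _ _ _ n20).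
- exact: (flatwall _ _ _ _ f0 ss).
- exact: (flatwall _ _ _ _ f0 nn).
- exact: (flatwall' _ _ _ _ f0 ss).
- exact: (flatwall' _ _ _ _ f0 nn).
- exact: (otherflat _ _ _ _ _ n02).
- exact: (sameflat _ _ _ _ _ r2).
Qed.

Definition row2 (s t : R) : 'rV[R]_2 := \row_i (if i == 0 then s else t).

Lemma row2_closed s t : 0 <= s <= 1 -> 0 <= t <= 1 -> closed_square (row2 s t).
Proof. by move=> hs ht i; rewrite mxE; case: ifP. Qed.

Lemma ratioP (y c : R) : - c <= y <= c ->
  exists2 t, 0 <= t <= 1 & (2 * t - 1) * c = y.
Proof.
move=> /andP[y1 y2]; have [c0|c0] := eqVneq c 0.
  (* At the apex, c = 0 forces y = 0 and any parameter would do. *)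
  by exists 0; [rewrite lexx ler01|rewrite c0 mulr0; lra].
have cp : 0 < c by rewrite lt_neqAle eq_sym c0 /=; lra.
exists ((y / c + 1) / 2); last by field.
have a1 : y / c <= 1 by rewrite ler_pdivrMr// mul1r.
have a2 : -1 <= y / c by rewrite ler_pdivlMr// mulN1r.
by apply/andP; split; lra.
Qed.

Lemma wall_patch_range (s : R) p : s * s = 1 ->
  (exists2 q, closed_square q & wall_patch e1 e2 e3 s q = p) <->
  [/\ 1 <= dot p e3 <= 2, dot p e1 = s * cap (dot p e3) &
    - cap (dot p e3) <= dot p e2 <= cap (dot p e3)].
Proof.
move=> ss; split.
  move=> [q cq <-]; rewrite !(dot_pt o) rise_cap.
  have /andP[p0 p1] := cq 0; have /andP[p2 p3] := cq 1.
  have c0 : 0 <= cap (1 + q 0 0) by rewrite /cap; nra.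
  split=> //; first by apply/andP; split; lra.
  by move: (cap _) c0 => c c0; apply/andP; split; nra.
move=> [/andP[z1 z2] xE /ratioP[t t01 tE]].
exists (row2 (dot p e3 - 1) t); first by apply: row2_closed => //; apply/andP; split; lra.
apply: (frame_inj o); rewrite !(dot_pt o) ?rise_cap !mxE /= ?(addrC 1) subrK //.
Qed.

Lemma flat_patch_range (r z : R) p : 0 < r ->
  (exists2 q, closed_square q & flat_patch e1 e2 e3 r z q = p) <->
  [/\ dot p e3 = z, - r <= dot p e1 <= r & - r <= dot p e2 <= r].
Proof.
move=> r0; split.
  move=> [q cq <-]; rewrite !(dot_pt o).
  have /andP[p0 p1] := cq 0; have /andP[p2 p3] := cq 1.
  by split=> //; apply/andP; split; nra.
move=> [zE /ratioP[s s01 sE] /ratioP[t t01 tE]].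
exists (row2 s t); first exact: row2_closed.
by apply: (frame_inj o); rewrite !(dot_pt o) ?mxE //= mulrC.
Qed.

End MirrorSurface.

(** * The boundary as a piecewise smooth surface *)

Section MirrorPiecewise.
Context {R : realType} {e1 e2 e3 : 'rV[R]_3} (o : orthonormal e1 e2 e3).
Let o' := orthonormal_swap o.

Lemma shape_boundary (x y z : R) : shape x y z /\ ~ core x y z <->
  (exists2 s, s * s = 1 & [/\ 1 <= z <= 2, x = s * cap z & - cap z <= y <= cap z]) \/
  (exists2 s, s * s = 1 & [/\ 1 <= z <= 2, y = s * cap z & - cap z <= x <= cap z]) \/
  [/\ z = 2, - (3 / 2) <= x <= 3 / 2 & - (3 / 2) <= y <= 3 / 2] \/
  [/\ z = 0, -2 <= x <= 2 & -2 <= y <= 2].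
Proof.
have ss : (1 : R) * 1 = 1 by rewrite mulr1.
have nn : (-1 : R) * -1 = 1 by rewrite mulrNN mulr1.
have c2 : cap (2 : R) = 3 / 2 by rewrite /cap; field.
have cge (u : R) : 1 <= u -> 0 <= cap u by rewrite /cap; nra.
have sq (s c : R) : s * s = 1 -> 0 <= c -> - c <= s * c <= c.
  move=> h c0; apply/andP; split; nra.
split.
  move=> [[[zz /andP[x1 x2] /andP[y1 y2]]|[? ? ?]] nc]; last by do 3!right.
  have /andP[z1 z2] := zz.
  have [e|] := eqVneq x (cap z).
    by left; exists 1 => //; split; rewrite ?mul1r//; apply/andP.
  move=> nx; have [e|] := eqVneq x (- cap z).
    by left; exists (-1) => //; split; rewrite ?mulN1r//; apply/andP.
  move=> nx'; have [e|] := eqVneq y (cap z).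
    by right; left; exists 1 => //; split; rewrite ?mul1r//; apply/andP.
  move=> ny; have [e|] := eqVneq y (- cap z).
    by right; left; exists (-1) => //; split; rewrite ?mulN1r//; apply/andP.
  move=> ny'; have [e|nz] := eqVneq z 2.
    by right; right; left; rewrite -c2 -e; split=> //; apply/andP.
  case: nc; split; apply/andP.
  (* z = 1 would force x = 0 = cap z, a case already set aside. *)
  - rewrite !lt_neqAle z2 nz z1 !andbT; split=> //; apply/eqP => z11.
    by move: nx; rewrite /cap -z11 => /eqP; apply; move: x1 x2; rewrite /cap -z11; lra.
  - by rewrite !lt_neqAle x1 x2 nx eq_sym nx'.
  - by rewrite !lt_neqAle y1 y2 ny eq_sym ny'.
have ncore (s c : R) : s * s = 1 -> - c < s * c < c -> False.
  by move=> /sqr1_sign[] -> /andP[]; lra.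
case=> [[s h [zz -> yy]]|[[s h [zz -> xx]]|[[-> xx yy]|[z0 xx yy]]]].
- split; last by case=> _ /(ncore _ _ h).
  by left; split=> //; apply: sq => //; apply: cge; case/andP: zz.
- split; last by case=> _ _ /(ncore _ _ h).
  by left; split=> //; apply: sq => //; apply: cge; case/andP: zz.
- split; last by case=> /andP[_]; rewrite ltxx.
  by left; split; rewrite ?c2//; apply/andP; split; lra.
- split; first by right.
  by case=> /andP[+ _] _ _; rewrite z0; lra.
Qed.

Lemma mirror_surface : piecewise_smooth_surface (boundary (mirror e1 e2 e3)).
Proof.
have ss : (1 : R) * 1 = 1 by rewrite mulr1.
have nn : (-1 : R) * -1 = 1 by rewrite mulrNN mulr1.
have r32 : 0 < (3 / 2 : R) by lra.
have r2 : 0 < (2 : R) by lra.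
exists 6, (@mirror_patch R e1 e2 e3); split.
- by case=> -[|[|[|[|[|[|//]]]]]] ? /=;
    [exact: wall_patch_smooth|exact: wall_patch_smooth|exact: wall_patch_smooth|
     exact: wall_patch_smooth|exact: flat_patch_smooth|exact: flat_patch_smooth].
- by case=> -[|[|[|[|[|[|//]]]]]] ? p op; rewrite /mirror_patch /=;
    [exact: (wall_patch_rank o)|exact: (wall_patch_rank o)|exact: (wall_patch_rank o')|
     exact: (wall_patch_rank o')|apply: (flat_patch_rank o)|apply: (flat_patch_rank o)];
    rewrite // gt_eqF.
- by move=> i j p q; exact: (mirror_patch_inj o).
- apply/seteqP; split=> [p /(mirror_boundaryE o)/shape_boundary|p [i _]].
    have Ord k (h : (k < 6)%N) q : closed_square q -> @mirror_patch R e1 e2 e3 (Ordinal h) q = p ->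
        (\bigcup_(i in [set: 'I_6]) (@mirror_patch R e1 e2 e3 i @` closed_square)) p.
      by move=> cq <-; exists (Ordinal h) => //; exists q.
    case=> [[s h]|[[s h]|[h|h]]].
    + case: (sqr1_sign h) => sE /(proj2 (wall_patch_range o _ h)) [q cq]; rewrite sE.
        exact: (@Ord 0%N isT q cq).
      exact: (@Ord 1%N isT q cq).
    + case: (sqr1_sign h) => sE /(proj2 (wall_patch_range o' _ h)) [q cq]; rewrite sE.
        exact: (@Ord 2%N isT q cq).
      exact: (@Ord 3%N isT q cq).
    + have [q cq] := proj2 (flat_patch_range o 2 p r32) h.
      exact: (@Ord 4%N isT q cq).
    + have [q cq] := proj2 (flat_patch_range o 0 p r2) h.
      exact: (@Ord 5%N isT q cq).
  move=> ip; apply/(mirror_boundaryE o)/shape_boundary.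
  case: i ip => -[|[|[|[|[|[|//]]]]]] ?; rewrite /mirror_patch /=.
  + by move=> /(wall_patch_range o _ ss) h; left; exists 1.
  + by move=> /(wall_patch_range o _ nn) h; left; exists (-1).
  + by move=> /(wall_patch_range o' _ ss) h; right; left; exists 1.
  + by move=> /(wall_patch_range o' _ nn) h; right; left; exists (-1).
  + by move=> /(flat_patch_range o _ _ r32) h; right; right; left.
  + by move=> /(flat_patch_range o _ _ r2) h; right; right; right.
Qed.

End MirrorPiecewise.

(** * Positive volume *)

Section Volume.
Context {R : realType}.
Local Notation mu := (@lebesgue_measure R).

(** Row vectors carry the maximum norm, so a ball is a product of three intervals, whose measure is
    (2 e)^3. *)
Lemma volume_gt0 (A : set 'rV[R]_3) (p : 'rV[R]_3) : nbhs p A -> (0 < volume A)%E.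
Proof.
move=> /nbhs_ballP[e /= e0 eA].
pose I i : set R := `](p 0 i - e), (p 0 i + e)[%classic.
have mI i : measurable (I i) by exact: measurable_itv.
have muI i : mu (I i) = (2 * e)%:E.
  rewrite lebesgue_measure_itv /= lte_fin ifT; last by lra.
  by rewrite -EFinB; congr EFin; ring.
have mI01 : measurable (I 0 `*` I 1) by exact: measurableX.
have e2 : (0 < (2 * e)%:E)%E by rewrite lte_fin; lra.
apply: (@lt_le_trans _ _ (((mu \x mu) \x mu)%E ((I 0 `*` I 1) `*` I 2%:R))).
  have mu01 : (mu \x mu)%E (I 0 `*` I 1) = ((2 * e)%:E * (2 * e)%:E)%E.
    apply: (etrans (product_measure1E mu mu (mI 0) (mI 1))).
    exact: (f_equal2 mule (muI 0) (muI 1)).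
  have mu012 : ((mu \x mu) \x mu)%E ((I 0 `*` I 1) `*` I 2%:R) =
      ((2 * e)%:E * (2 * e)%:E * (2 * e)%:E)%E.
    apply: (etrans (product_measure1E (mu \x mu)%E mu mI01 (mI 2%:R))).
    exact: (f_equal2 mule mu01 (muI 2%:R)).
  apply: (eq_ind_r (fun u => 0 < u)%E _ mu012).
  by rewrite mule_gt0// mule_gt0.
rewrite -(measurable_mu_extE ((mu \x mu) \x mu)%E (measurableX mI01 (mI 2%:R))).
apply: le_outer_measure => -[[x y] z] [[/= Ix Iy] Iz].
exists (\row_i nth 0 [:: x; y; z] i); last by rewrite !mxE.
apply: eA; split=> // i j; rewrite mxE (ord1 i).
have key (u : R) k : I k u -> ball (p 0 k) e u.
  by rewrite /I /= in_itv /= => /andP[u1 u2]; rewrite /ball /= ltr_norml; apply/andP; split; lra.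
case: j => -[|[|[|//]]] h /=.
- by rewrite (_ : Ordinal h = 0)//; [exact: key|exact/val_inj].
- by rewrite (_ : Ordinal h = 1)//; [exact: key|exact/val_inj].
- by rewrite (_ : Ordinal h = 2%:R)//; [exact: key|exact/val_inj].
Qed.

Lemma mirror_body (e1 e2 e3 : 'rV[R]_3) :
  orthonormal e1 e2 e3 -> body (mirror e1 e2 e3).
Proof.
move=> o; split; [exact: mirror_bounded|exact: mirror_surface|].
(* The point (0, 0, 3/2) is in the core because cap (3/2) = 5/8 is positive. *)
apply: (@volume_gt0 _ (point e1 e2 e3 0 0 (3 / 2))).
rewrite -[nbhs _ _]/(interior _ _) (mirror_interior o) /= !(dot_pt o) /core /cap.
by split; apply/andP; split; lra.
Qed.

End Volume.

(** * Free motion and exit from C *)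

Section Rays.
Context {R : realType}.
Implicit Types (B C : set 'rV[R]_3) (p v xi : 'rV[R]_3).

(** The last time spent in the closure is a supremum, finite because [C] is bounded. Taking the last
    time and not the first yields the clause of [Exit] that the particle leaves for good. *)
Lemma exit_point C p v : bounded_set C -> dot v v = 1 -> closure C p ->
  exists t, [/\ 0 <= t, boundary C (p + t *: v) &
    forall s, 0 < s -> ~ closure C (p + t *: v + s *: v)].
Proof.
move=> bC v1 Cp; have [M M0 CM] := dot_bounded v bC.
pose S := [set s : R | 0 <= s /\ closure C (p + s *: v)].
have S0 : S 0 by split; rewrite ?lexx ?scale0r ?addr0.
have ubS : ubound S (M + `|dot p v|).
  move=> s [_ /CM]; rewrite dotDl dotZl v1 mulr1 ler_norml => /andP[_ h].
  by have := ler_norm (- dot p v); rewrite normrN; lra.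
have supS : has_sup S by split; [exists 0|exists (M + `|dot p v|)].
have t0 : 0 <= sup S by exact: (ub_le_sup supS.2 S0).
have out s : 0 < s -> ~ closure C (p + sup S *: v + s *: v).
  move=> s0; rewrite -addrA -scalerDl => h.
  have := ub_le_sup supS.2 (conj (addr_ge0 t0 (ltW s0)) h); lra.
exists (sup S); split=> //; split; last first.
  move=> /(interior_line v)[e e0 /(_ (e / 2))].
  rewrite gtr0_norm; last lra.
  move=> h; apply: (out (e / 2)); first lra.
  by apply: subset_closure; apply: h; lra.
apply: contrapT => nC.
have : interior (~` closure C) (p + sup S *: v).
  by apply: open_nbhs_nbhs; split=> //; exact: closed_openC (@closed_closure _ C).
move=> /(interior_line v)[e e0 he].
have [s [s0 Cs] es] := sup_adherent e0 supS.
have sS : s <= sup S by apply: ub_le_sup (conj s0 Cs) => //; exact: supS.2.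
apply: (he (s - sup S)); first by rewrite ltr_norml; apply/andP; split; lra.
by rewrite -addrA -scalerDl [sup S + _]addrC subrK.
Qed.

(** A single event from which both zero resistance and invisibility follow, so that one
    almost-everywhere statement serves both. *)
Definition transparent B C v xi : Prop :=
  exists xi', scattering B C xi v xi' v /\ parallel (xi' - xi) v.

Lemma miss_transparent B C v xi : bounded_set C -> dot v v = 1 -> closure C xi ->
  (forall s, ~ closure B (xi + s *: v)) -> transparent B C v xi.
Proof.
move=> bC v1 Cxi miss; have [t [t0 bt out]] := exit_point bC v1 Cxi.
exists (xi + t *: v); split; last by exists t; rewrite addrC addKr.
left; split; first by have := miss 0; rewrite scale0r addr0.
by apply: (@Exit _ _ _ _ _ _ _ t).
Qed.

End Rays.

(** * The three reflections *)

Section Scattering.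
Context {R : realType} {e1 e2 e3 : 'rV[R]_3} (o : orthonormal e1 e2 e3).
Local Notation pt := (point e1 e2 e3).
Local Notation B := (mirror e1 e2 e3).

Lemma ptD a b c t a' b' c' :
  pt a b c + t *: pt a' b' c' = pt (a + t * a') (b + t * b') (c + t * c').
Proof. by apply: (frame_inj o); rewrite dotDl dotZl !(dot_pt o). Qed.

Lemma e1_pt : e1 = pt 1 0 0.
Proof. by rewrite /point !scale0r scale1r !addr0. Qed.

Lemma pt_shift a b c t : pt a b c + t *: e1 = pt (a + t) b c.
Proof. by rewrite {2}e1_pt ptD !mulr0 !addr0 mulr1. Qed.

Lemma pt_diff a x b c : pt a b c - pt x b c = (a - x) *: e1.
Proof.
by have := pt_shift x b c (a - x); rewrite [x + _]addrC subrK => <-; rewrite addrC addKr.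
Qed.

Lemma e3_pt : e3 = pt 0 0 1.
Proof. by rewrite /point !scale0r scale1r !add0r. Qed.

Lemma mirror_pt a b c : B (pt a b c) <-> shape a b c.
Proof. by rewrite /mirror /= !(dot_pt o). Qed.

Lemma wall_normal_pt s z : wall_normal e1 e3 s z =
  pt ((Num.sqrt (1 + z ^+ 2))^-1 * s) 0 (- ((Num.sqrt (1 + z ^+ 2))^-1 * z)).
Proof.
apply: (frame_inj o); rewrite !(dot_pt o) /wall_normal dotZl dotBl !dotZl;
  case: o => h1 h2 h3 h12 h13 h23;
  by rewrite ?h1 ?h12 ?h13 ?(dotC e3 e1) ?(dotC e3 e2) ?h3 ?h13 ?h23; ring.
Qed.

Lemma reflection_pt a b c a' b' c' :
  reflection (pt a' b' c') (pt a b c) =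
  pt (a - 2 * (a * a' + b * b' + c * c') * a') (b - 2 * (a * a' + b * b' + c * c') * b')
     (c - 2 * (a * a' + b * b' + c * c') * c').
Proof.
rewrite /reflection (dot_frame o (pt a b c)) !(dot_pt o).
by apply: (frame_inj o); rewrite dotBl dotZl !(dot_pt o).
Qed.

(** The unit vector from (-cap z, y, z) to the focus (0, y, 0). Since cap(z)^2 + z^2 = ((1 +
    z^2)/2)^2, the distance is rational in z; it is the flight time to the sheet. *)
Definition dip z : 'rV[R]_3 := pt ((z ^+ 2 - 1) / (1 + z ^+ 2)) 0 (- (2 * z / (1 + z ^+ 2))).
Definition climb z : 'rV[R]_3 := pt ((z ^+ 2 - 1) / (1 + z ^+ 2)) 0 (2 * z / (1 + z ^+ 2)).

Let z20 z : 1 + z ^+ 2 != 0 :> R.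
Proof. by rewrite gt_eqF// ltr_wpDr// sqr_ge0. Qed.

(** A reflection is quadratic in the normal, so the normalizing square root enters only through its
    square. *)
Let sqrV z : (Num.sqrt (1 + z ^+ 2))^-1 * (Num.sqrt (1 + z ^+ 2))^-1 = (1 + z ^+ 2)^-1 :> R.
Proof. by rewrite -invfM -expr2 sqr_sqrtr// addr_ge0// sqr_ge0. Qed.

Lemma reflection_in z : reflection (wall_normal e1 e3 (-1) z) e1 = dip z.
Proof.
rewrite wall_normal_pt {2}e1_pt reflection_pt /dip.
have := sqrV z; set r := _^-1 => rr.
congr pt; last first.
- transitivity (- (2 * z * (r * r))); first by ring.
  by rewrite rr.
- by ring.
- transitivity (1 - 2 * (r * r)); first by ring.
  by rewrite rr; field; rewrite ?z20.
Qed.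

Lemma reflection_sheet z : reflection e3 (dip z) = climb z.
Proof. by rewrite e3_pt reflection_pt /climb; congr pt; ring. Qed.

Lemma reflection_out z : reflection (wall_normal e1 e3 1 z) (climb z) = e1.
Proof.
rewrite wall_normal_pt reflection_pt [RHS]e1_pt.
have := sqrV z; set r := (Num.sqrt _)^-1 => rr.
congr pt.
- transitivity ((z ^+ 2 - 1) / (1 + z ^+ 2) -
    2 * ((z ^+ 2 - 1) / (1 + z ^+ 2) - 2 * z / (1 + z ^+ 2) * z) * (r * r)); first by ring.
  by rewrite rr; field; rewrite ?z20.
- by ring.
- transitivity (2 * z / (1 + z ^+ 2) +
    2 * ((z ^+ 2 - 1) / (1 + z ^+ 2) - 2 * z / (1 + z ^+ 2) * z) * (r * r) * z); first by ring.
  by rewrite rr; field; rewrite ?z20.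
Qed.

(* (0, y, 0) is the focus of both parabolas x = +-cap z, so the segment joining
   it to a point of a parabola stays on the concave side. *)
Lemma focal_segment (y z m : R) : 1 < z -> 0 < m < 1 ->
  ~ shape (m * cap z) y (m * z).
Proof.
move=> z1 /andP[m0 m1] [[/andP[mz1 _] /andP[_ h] _]|[]].
  (* The inequality m cap z <= cap (m z) amounts to (1 - m)(1 + m z^2) <= 0. *)
  by move: h; rewrite /cap exprMn; nra.
by move/eqP; rewrite mulf_eq0 gt_eqF//= gt_eqF//; lra.
Qed.

Section Chord.
Variables (y z : R).
Hypotheses (zz : 1 < z < 2) (yy : - cap z < y < cap z).

Let z1 : 1 < z. Proof. by case/andP: zz. Qed.
Let h0 : 0 < cap z. Proof. by have := z1; rewrite /cap; nra. Qed.
Let h2 : cap z < 2. Proof. by case/andP: zz => *; rewrite /cap; nra. Qed.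
Let t0 : 0 < (1 + z ^+ 2) / 2 :> R.
Proof. by rewrite divr_gt0// ltr_wpDr// sqr_ge0. Qed.


Lemma wall_hit (s : R) : s * s = 1 ->
  unit_normal (boundary B) (pt (s * cap z) y z) (wall_normal e1 e3 s z).
Proof.
move=> ss; have := @mirror_wall_normal R e1 e2 e3 o s (pt (s * cap z) y z) ss.
by rewrite !(dot_pt o); exact.
Qed.

Lemma bounce_in x : x < - cap z ->
  bounce B (pt x y z) e1 (pt (- cap z) y z) (dip z).
Proof.
move=> xh; exists (- cap z - x), (wall_normal e1 e3 (-1) z); split.
- lra.
- by rewrite pt_shift; congr pt; ring.
- move=> s /andP[s0 st]; rewrite mirror_closure pt_shift mirror_pt.
  case=> [[_ /andP[h _] _]|[]]; first lra.
  by case/andP: zz => *; lra.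
- by have := @wall_hit (-1); rewrite (mulN1r (cap z)); apply; rewrite mulrNN mulr1.
- by rewrite reflection_in.
Qed.

Lemma bounce_sheet : bounce B (pt (- cap z) y z) (dip z) (pt 0 y 0) (climb z).
Proof.
exists ((1 + z ^+ 2) / 2), e3; split=> //.
- by rewrite /dip ptD /cap; congr pt; field; rewrite ?z20.
- move=> s /andP[s0 st]; rewrite mirror_closure /dip ptD mirror_pt.
  (* The fraction of the way to the focus still ahead: the particle is at (-m cap z, y, m z). *)
  pose m := 1 - s / ((1 + z ^+ 2) / 2).
  have -> : - cap z + s * ((z ^+ 2 - 1) / (1 + z ^+ 2)) = - (m * cap z).
    by rewrite /m /cap; field; rewrite ?z20.
  have -> : z + s * - (2 * z / (1 + z ^+ 2)) = m * z.
    by rewrite /m; field; rewrite ?z20.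
  rewrite shapeNx; apply: focal_segment => //; rewrite /m.
  have s1 : 0 < s / ((1 + z ^+ 2) / 2) by rewrite divr_gt0.
  have s2 : s / ((1 + z ^+ 2) / 2) < 1 by rewrite ltr_pdivrMr// mul1r.
  by rewrite subr_gt0 s2 gtrBl.
- apply: (mirror_sheet_normal o); rewrite !(dot_pt o) //; apply/andP; split; try lra.
    by have := h2; case/andP: yy => *; lra.
  by have := h2; case/andP: yy => *; lra.
- by rewrite reflection_sheet.
Qed.

Lemma bounce_out : bounce B (pt 0 y 0) (climb z) (pt (cap z) y z) e1.
Proof.
exists ((1 + z ^+ 2) / 2), (wall_normal e1 e3 1 z); split=> //.
- by rewrite /climb ptD /cap; congr pt; field; rewrite ?z20.
- move=> s /andP[s0 st]; rewrite mirror_closure /climb ptD mirror_pt.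
  pose m := s / ((1 + z ^+ 2) / 2).
  have -> : 0 + s * ((z ^+ 2 - 1) / (1 + z ^+ 2)) = m * cap z.
    by rewrite /m /cap; field; rewrite ?z20.
  have -> : 0 + s * (2 * z / (1 + z ^+ 2)) = m * z.
    by rewrite /m; field; rewrite ?z20.
  apply: focal_segment => //; rewrite /m; apply/andP; split; first exact: divr_gt0.
  by rewrite ltr_pdivrMr// mul1r.
- by have := @wall_hit 1 (mulr1 1); rewrite mul1r.
- by rewrite reflection_out.
Qed.

Lemma hit_transparent C xi nu : bounded_set C -> B `<=` C ->
  outer_normal C xi nu -> dot nu e1 < 0 -> dot xi e2 = y -> dot xi e3 = z ->
  transparent B C e1 xi.
Proof.
move=> bC BC nP nv y_ z_.
have xiE : xi = pt (dot xi e1) y z by rewrite {1}(frameE o xi) y_ z_.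
move: (dot xi e1) xiE => x xiE; subst xi.
have onB (s : R) : s * s = 1 -> C (pt (s * cap z) y z).
  move=> ss; apply: BC; rewrite -mirror_closure; have [_ [g [_ + _ _ _]]] := wall_hit ss.
  by case.
have nn : (-1 : R) * -1 = 1 by rewrite mulrNN mulr1.
(* The point of the first wall belongs to [C], hence lies behind the supporting plane at the
   entrance; as nu . e1 < 0, it cannot precede the entrance on the line. *)
have x_le : x <= - cap z.
  by have := nP.2 _ (onB _ nn); rewrite mulN1r pt_diff dotZr; nra.
have e11 : dot e1 e1 = 1 by case: o.
have Cp : closure C (pt (cap z) y z).
  by apply: subset_closure; rewrite -[cap z]mul1r; apply: onB; rewrite mulr1.
have [t [t0' bt out]] := exit_point bC e11 Cp.
have leave : motion B C (pt (cap z) y z) e1 (pt (cap z) y z + t *: e1) e1.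
  apply: (@Exit _ _ _ _ _ _ _ t) => // s s0.
  rewrite mirror_closure pt_shift mirror_pt.
  case=> [[_ /andP[_ h] _]|[]]; first lra.
  by case/andP: zz => *; lra.
have M := Bounce bounce_sheet (Bounce bounce_out leave).
exists (pt (cap z) y z + t *: e1); split; last first.
  by exists (cap z + t - x); rewrite pt_shift pt_diff.
(* If the boundary of [C] touches the first wall at the entrance point, the scattering starts with
   the reflection itself. *)
have [xh|nx] := eqVneq x (- cap z).
  right; exists (wall_normal e1 e3 (-1) z); last by rewrite reflection_in xh.
  by rewrite xh -(mulN1r (cap z)); exact: wall_hit.
have xlt : x < - cap z by rewrite lt_neqAle nx.
left; split; last exact: Bounce (bounce_in xlt) M.
rewrite mirror_closure mirror_pt.
case=> [[_ /andP[h _] _]|[]]; first lra.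
by case/andP: zz => *; lra.
Qed.

End Chord.

End Scattering.

(** * Almost every ray is restored *)

Section Invisibility.
Context {R : realType} {e1 e2 e3 : 'rV[R]_3} (o : orthonormal e1 e2 e3).
Local Notation S2 := (@surface_outer_measure R).
Local Notation B := (mirror e1 e2 e3).

Lemma surface_areaU0 (A1 A2 : set 'rV[R]_3) :
  S2 A1 = 0%E -> S2 A2 = 0%E -> S2 (A1 `|` A2) = 0%E.
Proof.
move=> h1 h2; apply/eqP; rewrite eq_le outer_measure_ge0 andbT.
by apply: le_trans (outer_measureU2 _ _ _) _; rewrite h1 h2 adde0.
Qed.

Lemma across_le (w : 'rV[R]_3) (a : R) : 0 <= a ->
  dot w e2 ^+ 2 + dot w e3 ^+ 2 <= a ^+ 2 -> enorm (w - dot w e1 *: e1) <= a.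
Proof.
move=> a0 wa; rewrite enorm_le//; apply: le_trans wa.
rewrite (dot_frame o) !dotBl !dotZl.
by case: o => -> _ _ -> -> _; lra.
Qed.

(** A ray along [e1] in one of these planes travels in the plane of the sheet or of the top face and
    could meet it only edge-on. *)
Definition grazing : set 'rV[R]_3 :=
  [set p | dot p e3 = 0] `|` [set p | dot p e3 = 2].

(** The added curves carry the rays through the edges shared by two walls, and through the apex at z
    = 1. *)
Definition singular_ray : set 'rV[R]_3 := grazing `|`
  [set p | 1 <= dot p e3 <= 2 /\
    (dot p e2 = cap (dot p e3) \/ dot p e2 = - cap (dot p e3))].

(** The distance to a plane orthogonal to [e3] is 1-Lipschitz, and the plane is its sublevel set at
    0. *)
Lemma grazing_caratheodory : S2.-caratheodory grazing.
Proof.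
have H c : S2.-caratheodory [set p | dot p e3 = c].
  rewrite (_ : [set p | _] = [set p | `|dot p e3 - c| <= 0]).
    apply: caratheodory_sublevel => x y.
    apply: le_trans (lerB_dist _ _) _; rewrite opprB addrA subrK -dotBl.
    by apply: abs_dot_le; case: o.
  by apply/seteqP; split=> p /=; rewrite normr_le0 subr_eq0 => /eqP.
exact: caratheodory_measurable_setU.
Qed.

Lemma singular_transversal0 C : bounded_set C ->
  S2 (transversal C e1 `&` singular_ray) = 0%E.
Proof.
move=> bC; have e11 : dot e1 e1 = 1 by case: o.
have line c : S2 (transversal C e1 `&` [set p | dot p e3 = c]) = 0%E.
  have [M M0 CM] := dot_bounded e2 bC.
  apply: (@transversal_curve0 _ C e1 _ (fun p => dot p e2) (- M) M 1) => //.
    by move=> x [[nu nx _] _]; rewrite -ler_norml; apply: CM; case: (outer_normal_boundary nx).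
  move=> x y [_ /= xc] [_ /= yc]; rewrite mul1r; apply: across_le => //.
  by rewrite !dotBl xc yc subrr expr0n addr0 real_normK ?num_real.
have curve (s : R) : s * s = 1 ->
    S2 (transversal C e1 `&` [set p | 1 <= dot p e3 <= 2 /\ dot p e2 = s * cap (dot p e3)]) = 0%E.
  (* The slope of [cap] on [1, 2] is at most 2, so over z the curve is Lipschitz with constant sqrt
     5 <= 3. *)
  move=> ss; apply: (@transversal_curve0 _ C e1 _ (fun p => dot p e3) 1 2 3) => //.
    by move=> x [_ []].
  move=> x y [_ [/andP[x1 x2] xE]] [_ [/andP[y1 y2] yE]].
  apply: across_le; first by rewrite mulr_ge0.
  rewrite !dotBl xE yE exprMn real_normK ?num_real//.
  move: (dot x e3) (dot y e3) x1 x2 y1 y2 => z t *.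
  have -> : (s * cap z - s * cap t) ^+ 2 = (s * s) * ((z - t) ^+ 2 * ((z + t) / 2) ^+ 2).
    by rewrite /cap; field.
  rewrite ss mul1r; have d0 := sqr_ge0 (z - t).
  have d4 : ((z + t) / 2) ^+ 2 <= 4 by nra.
  nra.
apply/eqP; rewrite eq_le outer_measure_ge0 andbT.
rewrite -(surface_areaU0 (surface_areaU0 (line 0) (line 2))
  (surface_areaU0 (curve 1 (mulr1 1)) (curve (-1) (etrans (mulrNN 1 1) (mulr1 1))))).
apply: le_outer_measure => p [tp [[p0|p2]|[zz [yE|yE]]]].
- by left; left; split.
- by left; right; split.
- by right; left; split=> //; split=> //; rewrite mul1r.
- by right; right; split=> //; split=> //; rewrite mulN1r.
Qed.

(* A line along e1 through the open trapezoid with vertices (+-3/2, 2), (+-2, 0)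
   of the (e2, e3)-plane meets the interior of the convex hull of B. *)
Lemma no_tangent C xi nu : B `<=` C -> outer_normal C xi nu -> dot nu e1 = 0 ->
  1 <= dot xi e3 < 2 -> - cap (dot xi e3) <= dot xi e2 <= cap (dot xi e3) -> False.
Proof.
move=> BC nP n1 /andP[z1 z2] /andP[y1 y2].
have n0 := outer_normal_unit nP; rewrite (dot_frame o) n1 mul0r add0r in n0.
have H a c : shape 0 a c ->
    dot nu e2 * (a - dot xi e2) + dot nu e3 * (c - dot xi e3) <= 0.
  move=> S; have := nP.2 (point e1 e2 e3 0 a c); rewrite (dot_frame o) n1 mul0r add0r.
  rewrite !dotBl !(dot_pt o); apply; apply: BC.
  by rewrite /mirror /= !(dot_pt o).
have c2 : cap (2 : R) = 3 / 2 by rewrite /cap; field.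
have t1 : shape 0 (3 / 2 : R) 2 by left; rewrite /solid c2; split; apply/andP; split; lra.
have t2 : shape 0 (- (3 / 2) : R) 2 by left; rewrite /solid c2; split; apply/andP; split; lra.
have b1 : shape 0 (2 : R) 0 by right; split=> //; apply/andP; split; lra.
have b2 : shape 0 (-2 : R) 0 by right; split=> //; apply/andP; split; lra.
move: (H _ _ t1) (H _ _ t2) (H _ _ b1) (H _ _ b2) => {H}.
move: (dot nu e2) (dot nu e3) n0 (dot xi e2) (dot xi e3) z1 z2 y1 y2.
move=> b g n0 y z z1 z2 y1 y2 h1 h2 h3 h4.
have cz : cap z < 3 / 2 by rewrite /cap; nra.
(* At height z the slanted side of the trapezoid is at y = s (2 - z/4), the mean of (3 s/2, 2) and
   (2 s, 0) with weights z/2 and 1 - z/2, for which the terms in g cancel. It lies beyond |y| <= cap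
   z < 3/2. *)
have comb (s : R) : z * (b * (s * (3 / 2) - y) + g * (2 - z)) +
    (2 - z) * (b * (s * 2 - y) + g * (0 - z)) = 2 * b * (s * (2 - z / 4) - y).
  by field.
have b0 : b = 0.
  have [b0|b0|//] := ltgtP b 0.
    have q : -1 * (2 - z / 4) - y < 0 by lra.
    suff : 2 * b * (-1 * (2 - z / 4) - y) <= 0 by nra.
    by rewrite -comb -[leRHS]addr0; apply: lerD; apply: mulr_ge0_le0; lra.
  have q : 0 < 1 * (2 - z / 4) - y by lra.
  suff : 2 * b * (1 * (2 - z / 4) - y) <= 0 by nra.
  by rewrite -comb -[leRHS]addr0; apply: lerD; apply: mulr_ge0_le0; lra.
subst b.
(* With b = 0, the vertices above and below height z force g = 0, against the unit length of the
   normal. *)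
have g1 : g * (2 - z) <= 0 by lra.
have g2 : g * (0 - z) <= 0 by lra.
nra.
Qed.

Lemma almost_every_transparent C : bounded_set C -> B `<=` C ->
  almost_every_incoming C e1 (transparent B C e1).
Proof.
move=> bC BC; have e11 : dot e1 e1 = 1 by case: o.
apply: (@negligible_incoming _ C e1 grazing (transversal C e1 `&` singular_ray)).
- exact: grazing_caratheodory.
- exact: singular_transversal0.
- by move=> xi gxi txi; split=> //; left.
move=> xi [nu nP nv] bad.
have [gxi|ngxi] := pselect (grazing xi); [by left|right].
have zN0 : dot xi e3 <> 0 by move=> z0; apply: ngxi; left.
have zN2 : dot xi e3 != 2 by apply/eqP => z2; apply: ngxi; right.
have [s hit] : exists s, shape (dot xi e1 + s) (dot xi e2) (dot xi e3).
  apply: contrapT => miss; apply: bad; apply: miss_transparent => //.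
    by case: (outer_normal_boundary nP).
  move=> s; rewrite mirror_closure /mirror /= !dotDl !dotZl.
  case: (o) => -> _ _ -> -> _; rewrite mulr1 !mulr0 !addr0 => h.
  by apply: miss; exists s.
case: hit => [[/andP[z1 z2] _ yy]|[]//].
have zlt : dot xi e3 < 2 by rewrite lt_neqAle zN2.
(* What remains has 1 <= z < 2 and |y| <= cap z, where tangential entrance is impossible; a bad
   point left here is therefore transversal. *)
have [n0|n0] := eqVneq (dot nu e1) 0.
  by case: (no_tangent BC nP n0 _ yy); rewrite z1.
have nlt : dot nu e1 < 0 by rewrite lt_neqAle n0.
split; first by exists nu.
right; split; first by rewrite z1.
have [yE|yN] := eqVneq (dot xi e2) (cap (dot xi e3)); first by left.
have [yE|yN'] := eqVneq (dot xi e2) (- cap (dot xi e3)); first by right.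
exfalso; apply: bad; move/andP: yy => [y1 y2].
have yy : - cap (dot xi e3) < dot xi e2 < cap (dot xi e3).
  by rewrite !lt_neqAle y1 y2 yN eq_sym yN'.
apply: (hit_transparent o _ yy bC BC nP nlt erefl erefl).
rewrite zlt andbT; case/andP: yy => yl yr.
have : 0 < cap (dot xi e3) by lra.
by rewrite /cap; nra.
Qed.

Lemma almost_every_sub C v (P Q : 'rV[R]_3 -> Prop) : (forall xi, P xi -> Q xi) ->
  almost_every_incoming C v P -> almost_every_incoming C v Q.
Proof.
move=> PQ [A [mA A0 AP]]; exists A; split=> // xi [inc nQ]; apply: AP; split=> //.
by move=> /PQ.
Qed.

Lemma mirror_zero_resistance : zero_resistance B e1.
Proof.
move=> C [[bC _ _] _] BC; apply: almost_every_sub (almost_every_transparent bC BC).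
by move=> xi [xi' [sc _]]; exists xi'.
Qed.

Lemma mirror_invisible : invisible B e1.
Proof.
split; first exact: mirror_zero_resistance.
move=> C [[bC _ _] _] BC; apply: almost_every_sub (almost_every_transparent bC BC).
by move=> xi [xi' scp]; exists xi', e1.
Qed.

End Invisibility.

Theorem theorem1 (R : realType) (v1 v2 : 'rV[R]_3)
    (hv1 : enorm v1 = 1) (hv2 : enorm v2 = 1) (hv12 : dot v1 v2 = 0) :
  (exists B : set 'rV[R]_3,
     [/\ body B, zero_resistance B v1 & zero_resistance B v2]) /\
  (exists B : set 'rV[R]_3,
     [/\ body B, invisible B v1 & invisible B v2]).
Proof.
have d1 : dot v1 v1 = 1 by rewrite -sqr_enorm hv1 expr1n.
have d2 : dot v2 v2 = 1 by rewrite -sqr_enorm hv2 expr1n.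
have [v3 o] := orthonormal_complete d1 d2 hv12.
have i1 := mirror_invisible o; have := mirror_invisible (orthonormal_swap o).
rewrite mirror_swap => i2.
split; exists (mirror v1 v2 v3); split; first [exact: mirror_body|exact: i1|exact: i2|
  by case: i1|by case: i2].
Qed.
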